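(* Let $R$ be a commutative Noetherian ring with identity, let $\mathfrak{a}$ and $\mathfrak{b}$ be ideals of $R$ with $\mathfrak{b}\subseteq\mathfrak{a}$, let $M$ be a finitely generated $R$-module, and let $n$ be a non-negative integer such that the set $\bigl(\operatorname{Ass}_R H^{f_{\mathfrak{a}}^{\mathfrak{b}}(M)_n}_{\mathfrak{a}}(M)\bigr)_{\ge n}$ is finite. Then $$f_{\mathfrak{a}}^{\mathfrak{b}}(M)_n=f_{\mathfrak{a}}^{\mathfrak{b}}(M)^n.$$
   Context: $H^i_{\mathfrak{a}}(M)=\varinjlim_{n\ge 1}\operatorname{Ext}^i_R(R/\mathfrak{a}^n,M)$ is the $i$-th local cohomology module. The infimum of the empty set of integers is $\infty$. For a subset $T\subseteq\operatorname{Spec}(R)$ and a non-negative integer $n$, $(T)_{\ge n}=\{\mathfrak{p}\in T\mid \dim R/\mathfrak{p}\ge n\}$. For an $R$-module $X$, $\dim\operatorname{Supp}X$ is the supremum of $\dim R/\mathfrak{p}$ over $\mathfrak{p}\in\operatorname{Supp}X$; for $X=0$ it is less than every non-negative integer. For a finitely generated $R$-module $M$, ideals $\mathfrak{a},\mathfrak{b}$ and $n\in\mathbb{N}_0$: - the $\mathfrak{b}$-finiteness dimension of $M$ relative to $\mathfrak{a}$ is $f_{\mathfrak{a}}^{\mathfrak{b}}(M)=\inf\{i\in\mathbb{N}_0\mid \mathfrak{b}^tH^i_{\mathfrak{a}}(M)\neq 0\text{ for all }t\in\mathbb{N}\}$ (over any Noetherian ring, in particular over the localizations $R_{\mathfrak{p}}$);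 - the $n$th $\mathfrak{b}$-finiteness dimension of $M$ relative to $\mathfrak{a}$ is $f_{\mathfrak{a}}^{\mathfrak{b}}(M)_n=\inf\{i\in\mathbb{N}_0\mid \dim\operatorname{Supp}(\mathfrak{b}^tH^i_{\mathfrak{a}}(M))\ge n\text{ for all }t\in\mathbb{N}_0\}$; - the upper $n$th $\mathfrak{b}$-finiteness dimension of $M$ relative to $\mathfrak{a}$ is $f_{\mathfrak{a}}^{\mathfrak{b}}(M)^n=\inf\{f_{\mathfrak{a}R_{\mathfrak{p}}}^{\mathfrak{b}R_{\mathfrak{p}}}(M_{\mathfrak{p}})\mid \mathfrak{p}\in\operatorname{Spec}(R),\ \dim R/\mathfrak{p}\ge n\}$. If $f_{\mathfrak{a}}^{\mathfrak{b}}(M)_n=\infty$, the finiteness hypothesis on associated primes is regarded as vacuously satisfied. *)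

(* Defs.v *)
From HB Require Import structures.
From mathcomp Require Import all_boot all_order all_algebra.
From mathcomp Require Import generic_quotient finmap.
From mathcomp Require Import ring mathcomp_extra boolp classical_sets functions.
From mathcomp Require Import cardinality fsbigop constructive_ereal.

Set Implicit Arguments.
Unset Strict Implicit.
Unset Printing Implicit Defensive.

Import Order.TTheory GRing.Theory.

Local Open Scope classical_set_scope.
Local Open Scope quotient_scope.
Local Open Scope ring_scope.

(* A submodule of V is a bundled [submodClosed V]; an ideal of R is a submodule
   of the regular module R^o.  Unlike [idealr], this allows the unit ideal. *)

Section Submodules.
Variables (R : comPzRingType).

Section Carrier.
Variables (V : lmodType R) (N : submodClosed V).

Lemma submN x : x \in N -> - x \in N.
Proof. by move=> Nx; rewrite -scaleN1r rpredZ. Qed.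

Definition subm := {x : V | x \in N}.
HB.instance Definition _ := SubChoice.on subm.
HB.instance Definition _ := [SubChoice_isSubLmodule of subm by <:].

Definition quotm_equiv (x y : V) := x - y \in N.

Lemma quotm_equivP : equiv_class_of quotm_equiv.
Proof.
rewrite /quotm_equiv; split=> [x|x y|y x z]; first by rewrite subrr rpred0.
  by apply/idP/idP => /submN; rewrite opprB.
by move=> xy yz; rewrite -[x](subrK y) -addrA rpredD.
Qed.

Canonical quotm_equiv_rel := EquivRelPack quotm_equivP.
Canonical quotm_encModRel := defaultEncModRel quotm_equiv.

Definition quotm := {eq_quot quotm_equiv}.
HB.instance Definition _ := Choice.on quotm.
HB.instance Definition _ : EqQuotient V quotm_equiv quotm := EqQuotient.on quotm.

Definition quotm_pi (x : V) : quotm := \pi_quotm x.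

Lemma quotm_eqP x y : quotm_pi x = quotm_pi y <-> x - y \in N.
Proof. by split=> [/eqmodP|?]; last apply/eqmodP. Qed.

Lemma repr_quotm x : repr (quotm_pi x) - x \in N.
Proof. by apply/quotm_eqP; rewrite /quotm_pi reprK. Qed.

Lemma quotmW (P : quotm -> Prop) : (forall x, P (quotm_pi x)) -> forall x, P x.
Proof. by move=> Pp x; rewrite -[x]reprK; apply: Pp. Qed.

Definition quotm_add (x y : quotm) := quotm_pi (repr x + repr y).
Definition quotm_opp (x : quotm) := quotm_pi (- repr x).
Definition quotm_scale (a : R) (x : quotm) := quotm_pi (a *: repr x).

Lemma quotm_addE x y :
  quotm_add (quotm_pi x) (quotm_pi y) = quotm_pi (x + y).
Proof. by apply/quotm_eqP; rewrite opprD addrACA rpredD ?repr_quotm. Qed.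

Lemma quotm_oppE x : quotm_opp (quotm_pi x) = quotm_pi (- x).
Proof. by apply/quotm_eqP; rewrite -opprD submN ?repr_quotm. Qed.

Lemma quotm_scaleE a x : quotm_scale a (quotm_pi x) = quotm_pi (a *: x).
Proof. by apply/quotm_eqP; rewrite -scalerBr rpredZ ?repr_quotm. Qed.

Lemma quotm_addA : associative quotm_add.
Proof. by do 3!elim/quotmW=> ?; rewrite !quotm_addE addrA. Qed.

Lemma quotm_addC : commutative quotm_add.
Proof. by do 2!elim/quotmW=> ?; rewrite !quotm_addE addrC. Qed.

Lemma quotm_add0 : left_id (quotm_pi 0) quotm_add.
Proof. by elim/quotmW=> ?; rewrite !quotm_addE add0r. Qed.

Lemma quotm_addN : left_inverse (quotm_pi 0) quotm_opp quotm_add.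
Proof. by elim/quotmW=> ?; rewrite quotm_oppE quotm_addE addNr. Qed.

HB.instance Definition _ := GRing.isZmodule.Build quotm
  quotm_addA quotm_addC quotm_add0 quotm_addN.

Lemma quotm_scaleA a b x :
  quotm_scale a (quotm_scale b x) = quotm_scale (a * b) x.
Proof. by elim/quotmW: x => x; rewrite !quotm_scaleE scalerA. Qed.

Lemma quotm_scale1 : left_id 1 quotm_scale.
Proof. by elim/quotmW=> x; rewrite quotm_scaleE scale1r. Qed.

Lemma quotm_scaleDr : right_distributive quotm_scale +%R.
Proof.
move=> a; do 2!elim/quotmW=> ?.
by rewrite [_ + _]quotm_addE !quotm_scaleE scalerDr -quotm_addE.
Qed.

Lemma quotm_scaleDl x : {morph quotm_scale^~ x : a b / a + b}.
Proof.
by elim/quotmW: x => x a b; rewrite !quotm_scaleE scalerDl -quotm_addE.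
Qed.

HB.instance Definition _ := GRing.Zmodule_isLmodule.Build R quotm
  quotm_scaleA quotm_scale1 quotm_scaleDr quotm_scaleDl.

Lemma quotm_pi_linear : linear quotm_pi.
Proof. by move=> a x y; rewrite -quotm_addE -quotm_scaleE. Qed.

HB.instance Definition _ := GRing.isLinear.Build R V quotm _ quotm_pi
  quotm_pi_linear.

End Carrier.

Definition span (V : lmodType R) (A : set V) : {pred V} :=
  fun x => `[< forall N : submodClosed V, A `<=` [set` N] -> x \in N >].

Lemma span_closed (V : lmodType R) (A : set V) : submod_closed (span A).
Proof.
split=> [|a x y]; rewrite ?unfold_in.
  by apply/asboolP => N _; rewrite rpred0.
move=> /asboolP Ax /asboolP Ay; apply/asboolP => N AN.
by rewrite rpredD ?rpredZ ?Ax ?Ay.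
Qed.

HB.instance Definition _ V A :=
  GRing.isSubmodClosed.Build R V (@span V A) (span_closed A).

Definition topm (V : lmodType R) : {pred V} := fun=> true.
Lemma topm_closed (V : lmodType R) : submod_closed (@topm V).
Proof. by []. Qed.
HB.instance Definition _ V :=
  GRing.isSubmodClosed.Build R V (@topm V) (@topm_closed V).

Definition botm (V : lmodType R) : {pred V} := fun x => x == 0.
Lemma botm_closed (V : lmodType R) : submod_closed (@botm V).
Proof.
split=> [|a x y]; rewrite !unfold_in /botm ?eqxx//.
by move=> /eqP-> /eqP->; rewrite scaler0 addr0.
Qed.
HB.instance Definition _ V :=
  GRing.isSubmodClosed.Build R V (@botm V) (@botm_closed V).

Definition finitely_generated (V : lmodType R) (N : submodClosed V) :=
  exists s : seq V, N =i span [set` s].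

(* I N; with V := R^o this is the product of two ideals. *)
Definition mulm (I : submodClosed R^o) (V : lmodType R) (N : submodClosed V)
    : submodClosed V :=
  span [set x | exists r y, [/\ r \in I, y \in N & x = (r : R) *: y]].

Fixpoint expi (I : submodClosed R^o) (t : nat) : submodClosed R^o :=
  if t is t'.+1 then mulm I (expi I t') else @topm R^o.

Section Linear.
Variables (U V : lmodType R).

Definition comap (f : {linear U -> V}) (N : submodClosed V) : {pred U} :=
  fun x => f x \in N.
Lemma comapE f N x : (x \in comap f N) = (f x \in N).
Proof. by []. Qed.
Lemma comap_closed f N : submod_closed (comap f N).
Proof.
split=> [|a x y]; rewrite !comapE ?linear0 ?rpred0//.
by move=> Nx Ny; rewrite linearP rpredD ?rpredZ.
Qed.
HB.instance Definition _ f N :=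
  GRing.isSubmodClosed.Build R U (comap f N) (comap_closed f N).

Definition kerm (f : {linear U -> V}) : submodClosed U := comap f (@botm V).

Definition imm (f : {linear U -> V}) : {pred V} :=
  fun y => `[< exists x, y = f x >].
Lemma imm_closed f : submod_closed (imm f).
Proof.
split=> [|a x y]; rewrite !unfold_in; first by apply/asboolP; exists 0; rewrite linear0.
move=> /asboolP[u ->] /asboolP[v ->]; apply/asboolP.
by exists (a *: u + v); rewrite linearP.
Qed.
HB.instance Definition _ f :=
  GRing.isSubmodClosed.Build R V (imm f) (imm_closed f).

Definition subm_map (f : {linear U -> V}) (A : submodClosed U)
  (B : submodClosed V) (fAB : {homo f : x / x \in A >-> x \in B})
  (x : subm A) : subm B := exist _ (f (val x)) (fAB _ (valP x)).
Lemma subm_map_linear f A B fAB : linear (@subm_map f A B fAB).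
Proof. by move=> a x y; apply: val_inj; rewrite /= linearP. Qed.
HB.instance Definition _ f A B fAB := GRing.isLinear.Build R _ _ _
  (@subm_map f A B fAB) (@subm_map_linear f A B fAB).

Definition quotm_map (f : {linear U -> V}) (A : submodClosed U)
  (B : submodClosed V) (fAB : {homo f : x / x \in A >-> x \in B})
  (x : quotm A) : quotm B := quotm_pi B (f (repr x)).
Lemma quotm_mapE f A B fAB x :
  @quotm_map f A B fAB (quotm_pi A x) = quotm_pi B (f x).
Proof. by apply/quotm_eqP; rewrite -linearB fAB ?repr_quotm. Qed.
Lemma quotm_map_linear f A B fAB : linear (@quotm_map f A B fAB).
Proof.
move=> a; do 2!elim/quotmW=> ?.
by rewrite -linearP !quotm_mapE -linearP -linearP.
Qed.
HB.instance Definition _ f A B fAB := GRing.isLinear.Build R _ _ _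
  (@quotm_map f A B fAB) (@quotm_map_linear f A B fAB).

End Linear.

Definition submv (V : lmodType R) (N : submodClosed V) (x : subm N) : V := val x.
Lemma submv_linear (V : lmodType R) N : linear (@submv V N).
Proof. by []. Qed.
HB.instance Definition _ (V : lmodType R) N :=
  GRing.isLinear.Build R (subm N) V _
  (@submv V N) (@submv_linear V N).

End Submodules.

Arguments topm {R} V _ /.
Arguments botm {R} V _ /.

Section Hom.
Variable R : comPzRingType.

Definition hom (U M : lmodType R) : {pred (U -> M)} := fun f => `[< linear f >].
Arguments hom U M _ : clear implicits.
Lemma hom_closed U M : submod_closed (hom U M).
Proof.
split=> [|a f g].
  by apply/asboolP => b x y; rewrite scaler0 addr0.
move=> /asboolP lf /asboolP lg; apply/asboolP => b x y.
have E z : (a *: f + g) z = a *: f z + g z by [].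
by rewrite !E lf lg !scalerDr !scalerA [a * b]mulrC addrACA.
Qed.
HB.instance Definition _ (U M : lmodType R) :=
  GRing.isSubmodClosed.Build R (U -> M) (hom U M) (@hom_closed U M).

Section Precomp.
Variables (U U' M : lmodType R) (g : {linear U' -> U}).

Definition precomp (f : U -> M) : U' -> M := f \o g.
Lemma precomp_linear : linear precomp.
Proof. by []. Qed.
HB.instance Definition _ := GRing.isLinear.Build R (U -> M) (U' -> M) _
  precomp precomp_linear.

Lemma precomp_hom : {homo precomp : f / f \in hom U M >-> f \in hom U' M}.
Proof.
move=> f /asboolP lf; apply/asboolP => a x y.
by rewrite /precomp /= linearP lf.
Qed.

Definition hom_map : {linear subm (hom U M) -> subm (hom U' M)} :=
  subm_map precomp_hom.
End Precomp.
End Hom.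
Arguments hom {R} U M _ : rename.

Section Free.
Variable R : comPzRingType.

Section FreeModule.
Variable X : choiceType.

Definition finsupp : {pred (X -> R^o)} :=
  fun u => `[< finite_set [set x | u x != 0] >].
Lemma finsupp_closed : submod_closed finsupp.
Proof.
split=> [|a u v].
  apply/asboolP; apply: (sub_finite_set _ (finite_set0 X)) => x /=.
  by rewrite eqxx.
move=> /asboolP fu /asboolP fv; apply/asboolP.
have fuv : finite_set ([set x | u x != 0] `|` [set x | v x != 0]).
  by rewrite finite_setU.
apply: sub_finite_set fuv => x /=.
case: (eqVneq (u x) 0) => [ux|]; last by left.
case: (eqVneq (v x) 0) => [vx|]; last by right.
by rewrite /GRing.add/= /GRing.scale/= ux vx scaler0 addr0 eqxx.
Qed.
HB.instance Definition _ :=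
  GRing.isSubmodClosed.Build R (X -> R^o) finsupp finsupp_closed.

Definition free := subm finsupp.

Definition free_gen (x : X) : X -> R^o := fun y => (x == y)%:R.
Lemma free_gen_subproof x : free_gen x \in finsupp.
Proof.
apply/asboolP; apply: (sub_finite_set _ (finite_set1 x)) => y /=.
by rewrite /free_gen; case: (eqVneq x y) => //; rewrite eqxx.
Qed.
Definition gen (x : X) : free := exist _ (free_gen x) (free_gen_subproof x).

Variables (V : lmodType R) (g : X -> V).

Definition lift (u : free) : V := \sum_(x \in [set: X]) (val u x : R) *: g x.

Lemma liftE (u : free) (A : {fset X}) : (forall x, x \notin A -> val u x = 0) ->
  lift u = \sum_(x <- A) (val u x : R) *: g x.
Proof. by move=> uA; apply: fsbigTE => x /uA ->; rewrite scale0r. Qed.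

Lemma suppP (u : free) : {A : {fset X} | forall x, x \notin A -> val u x = 0}.
Proof.
have fu : finite_set [set x | val u x != 0] by apply/asboolP; exact: valP u.
exists (fset_set [set x | val u x != 0]) => x.
rewrite in_fset_set//; apply: contraNeq => ux; by rewrite inE.
Qed.

Lemma lift_linear : linear lift.
Proof.
move=> a u v; have [A uA] := suppP u; have [B vB] := suppP v.
have nA x : x \notin (A `|` B)%fset -> x \notin A /\ x \notin B.
  by rewrite in_fsetU => /norP.
have E x : val (a *: u + v) x = a * val u x + val v x by [].
rewrite !(@liftE _ (A `|` B)%fset); first 1 last.
- by move=> x /nA[_ /vB].
- by move=> x /nA[/uA].
- by move=> x /nA[/uA ux /vB vx]; rewrite E ux vx mulr0 addr0.
rewrite scaler_sumr -big_split; apply: eq_bigr => x _.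
by rewrite E scalerDl scalerA.
Qed.
HB.instance Definition _ := GRing.isLinear.Build R free V _ lift lift_linear.

Lemma lift_gen x : lift (gen x) = g x.
Proof.
rewrite (@liftE _ [fset x]%fset) => [|y]; last first.
  by rewrite in_fset1 => yx; rewrite /= /free_gen eq_sym (negPf yx).
by rewrite big_seq_fset1 /= /free_gen eqxx scale1r.
Qed.

Lemma lift_uniq (h : {linear free -> V}) : (forall x, h (gen x) = g x) -> h =1 lift.
Proof.
move=> hg u; have [A uA] := suppP u; rewrite (liftE uA).
have Eu : u = \sum_(x <- A) (val u x : R) *: gen x.
  apply: val_inj; apply/funext => y.
  pose ev (w : free) : R := val w y.
  have evD : {morph ev : a b / a + b} by [].
  rewrite -[LHS]/(ev u) -[RHS]/(ev _) (big_morph ev evD (erefl : ev 0 = 0)).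
  have evg x : ev ((val u x : R) *: gen x) = val u x * (x == y)%:R by [].
  under eq_bigr do rewrite evg.
  have [yA|yA] := boolP (y \in A).
    rewrite (big_fsetD1 y)//= eqxx mulr1 big_seq big1 ?addr0// => x.
    by rewrite in_fsetD1 => /andP[/negPf-> _]; rewrite mulr0.
  rewrite big_seq big1 => [|x xA]; first exact: uA.
  by rewrite (_ : x == y = false) ?mulr0//; apply: contraNF yA => /eqP<-.
by rewrite [in LHS]Eu linear_sum; apply: eq_bigr => x _; rewrite linearZ/= hg.
Qed.
End FreeModule.

Lemma lift_ext (X : choiceType) (V : lmodType R) (h k : {linear free X -> V}) :
  (forall x, h (gen x) = k (gen x)) -> h =1 k.
Proof.
move=> hk u.
by rewrite (lift_uniq hk) -(@lift_uniq _ _ (fun x => k (gen x)) k).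
Qed.
End Free.

Arguments free {R} X.

Section Ext.
Variable R : comPzRingType.

(* The canonical free resolution of N: cover N by the free module on its own
   elements, take the kernel, and iterate.  It is functorial in N. *)

Definition aug (N : lmodType R) : {linear free N -> N} := lift id.

Definition syz (N : lmodType R) : lmodType R := subm (kerm (aug N)).

Section Functoriality.
Variables (N N' : lmodType R) (f : {linear N -> N'}).

Definition free_map : {linear free N -> free N'} := lift (fun x => gen R (f x)).

Lemma aug_natural u : aug N' (free_map u) = f (aug N u).
Proof.
pose h := aug N' \o free_map; pose k := f \o aug N.
apply: (@lift_ext _ _ _ h k) => x.
by rewrite /h /k /= !lift_gen.
Qed.

Lemma free_map_syz : {homo free_map : u / u \in kerm (aug N) >-> u \in kerm (aug N')}.
Proof.
move=> u; rewrite !comapE aug_natural => /eqP->.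
by rewrite linear0 rpred0.
Qed.

Definition syz_map : {linear syz N -> syz N'} := subm_map free_map_syz.

End Functoriality.

Fixpoint syzn (i : nat) (N : lmodType R) : lmodType R :=
  if i is i'.+1 then syz (syzn i' N) else N.

Fixpoint syzn_map (i : nat) (N N' : lmodType R) (f : {linear N -> N'}) :
    {linear syzn i N -> syzn i N'} :=
  if i is i'.+1 then syz_map (syzn_map i' f) else f.

(* The resolution ... -> res 1 N -> res 0 N (-> N). *)
Definition res (i : nat) (N : lmodType R) : lmodType R := free (syzn i N).

Definition res_d (i : nat) (N : lmodType R) : {linear res i.+1 N -> res i N} :=
  @submv _ _ (kerm (aug (syzn i N))) \o aug (syzn i.+1 N).

Definition res_map (i : nat) (N N' : lmodType R) (f : {linear N -> N'}) :
    {linear res i N -> res i N'} := free_map (syzn_map i f).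

Lemma res_d_natural i (N N' : lmodType R) (f : {linear N -> N'}) u :
  res_d i N' (res_map i.+1 f u) = res_map i f (res_d i N u).
Proof. by rewrite /res_d /= aug_natural. Qed.

Definition cochain (i : nat) (N M : lmodType R) : lmodType R :=
  subm (hom (res i N) M).

Definition cochain_d (i : nat) (N M : lmodType R) :
    {linear cochain i N M -> cochain i.+1 N M} :=
  hom_map M (res_d i N).

Definition cochain_map i (N N' M : lmodType R) (f : {linear N -> N'}) :
    {linear cochain i N' M -> cochain i N M} := hom_map M (res_map i f).

Lemma cochain_d_natural i (N N' M : lmodType R) (f : {linear N -> N'}) u :
  cochain_d i N M (cochain_map i M f u) =
  cochain_map i.+1 M f (cochain_d i N' M u).
Proof.
apply: val_inj; apply/funext => w.
by rewrite /= /precomp /= -res_d_natural.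
Qed.

Definition cocycle (i : nat) (N M : lmodType R) :
    submodClosed (cochain i N M) := kerm (cochain_d i N M).

Definition coboundary (i : nat) (N M : lmodType R) :
    submodClosed (cochain i N M) :=
  match i with
  | 0 => @botm R (cochain 0 N M)
  | j.+1 => imm (cochain_d j N M)
  end.

(* Ext^i_R(N, M) = H^i(Hom_R(res N, M)). *)
Definition ext (i : nat) (N M : lmodType R) : lmodType R :=
  quotm (comap (@submv _ _ (cocycle i N M)) (coboundary i N M)).

Lemma cochain_map_cocycle i (N N' M : lmodType R) (f : {linear N -> N'}) :
  {homo cochain_map i M f : u / u \in cocycle i N' M >-> u \in cocycle i N M}.
Proof.
move=> u; rewrite !comapE cochain_d_natural => /eqP->.
by rewrite linear0 rpred0.
Qed.

Lemma cochain_map_coboundary i (N N' M : lmodType R) (f : {linear N -> N'}) :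
  {homo cochain_map i M f :
     u / u \in coboundary i N' M >-> u \in coboundary i N M}.
Proof.
case: i => [|i] u /=; first by move=> /eqP->; rewrite linear0 rpred0.
move=> /asboolP[v ->]; apply/asboolP; exists (cochain_map i M f v).
by rewrite cochain_d_natural.
Qed.

Lemma ext_map_subproof i (N N' M : lmodType R) (f : {linear N -> N'}) :
  {homo subm_map (@cochain_map_cocycle i N N' M f) :
     u / u \in comap (@submv _ _ (cocycle i N' M)) (coboundary i N' M)
     >-> u \in comap (@submv _ _ (cocycle i N M)) (coboundary i N M)}.
Proof. by move=> u; exact: cochain_map_coboundary. Qed.

Definition ext_map i (N N' M : lmodType R) (f : {linear N -> N'}) :
  {linear ext i N' M -> ext i N M} := quotm_map (@ext_map_subproof i N N' M f).

End Ext.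

Section DirectLimit.
Variables (R : comPzRingType) (E : nat -> lmodType R).

Definition seqprod := forall n, E n.
HB.instance Definition _ := gen_eqMixin seqprod.
HB.instance Definition _ := gen_choiceMixin seqprod.

Definition seqprod_add (x y : seqprod) : seqprod := fun n => x n + y n.
Definition seqprod_opp (x : seqprod) : seqprod := fun n => - x n.
Definition seqprod_scale (a : R) (x : seqprod) : seqprod := fun n => a *: x n.

Lemma seqprod_addA : associative seqprod_add.
Proof. by move=> x y z; apply: functional_extensionality_dep => n; exact: addrA. Qed.
Lemma seqprod_addC : commutative seqprod_add.
Proof. by move=> x y; apply: functional_extensionality_dep => n; exact: addrC. Qed.
Lemma seqprod_add0 : left_id ((fun=> 0) : seqprod) seqprod_add.
Proof. by move=> x; apply: functional_extensionality_dep => n; exact: add0r. Qed.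
Lemma seqprod_addN : left_inverse ((fun=> 0) : seqprod) seqprod_opp seqprod_add.
Proof. by move=> x; apply: functional_extensionality_dep => n; exact: addNr. Qed.
HB.instance Definition _ := GRing.isZmodule.Build seqprod
  seqprod_addA seqprod_addC seqprod_add0 seqprod_addN.

Lemma seqprod_scaleA a b x :
  seqprod_scale a (seqprod_scale b x) = seqprod_scale (a * b) x.
Proof. by apply: functional_extensionality_dep => n; exact: scalerA. Qed.
Lemma seqprod_scale1 : left_id 1 seqprod_scale.
Proof. by move=> x; apply: functional_extensionality_dep => n; exact: scale1r. Qed.
Lemma seqprod_scaleDr : right_distributive seqprod_scale +%R.
Proof. by move=> a x y; apply: functional_extensionality_dep => n; exact: scalerDr. Qed.
Lemma seqprod_scaleDl x : {morph seqprod_scale^~ x : a b / a + b}.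
Proof. by move=> a b; apply: functional_extensionality_dep => n; exact: scalerDl. Qed.
HB.instance Definition _ := GRing.Zmodule_isLmodule.Build R seqprod
  seqprod_scaleA seqprod_scale1 seqprod_scaleDr seqprod_scaleDl.

Variable phi : forall n, {linear E n -> E n.+1}.

Definition compatible : {pred seqprod} :=
  fun x => `[< exists k, forall n, (k <= n)%N -> x n.+1 = phi n (x n) >].
Lemma compatible_closed : submod_closed compatible.
Proof.
split=> [|a x y]; first by apply/asboolP; exists 0%N => n _; rewrite linear0.
move=> /asboolP[k kx] /asboolP[l ly]; apply/asboolP; exists (maxn k l) => n.
rewrite geq_max => /andP[kn ln].
have ev m : (a *: x + y) m = a *: x m + y m by [].
by rewrite !ev kx// ly// linearP.
Qed.
HB.instance Definition _ :=
  GRing.isSubmodClosed.Build R seqprod compatible compatible_closed.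

Definition eventually0 : {pred seqprod} :=
  fun x => `[< exists k, forall n, (k <= n)%N -> x n = 0 >].
Lemma eventually0_closed : submod_closed eventually0.
Proof.
split=> [|a x y]; first by apply/asboolP; exists 0%N.
move=> /asboolP[k kx] /asboolP[l ly]; apply/asboolP; exists (maxn k l) => n.
rewrite geq_max => /andP[kn ln].
have ev m : (a *: x + y) m = a *: x m + y m by [].
by rewrite !ev kx// ly// scaler0 addr0.
Qed.
HB.instance Definition _ :=
  GRing.isSubmodClosed.Build R seqprod eventually0 eventually0_closed.

(* The direct limit of E 0 -> E 1 -> E 2 -> ...: sequences which eventually
   follow the transition maps, modulo those which are eventually zero.
   The class of x : E n is that of (0, ..., 0, x, phi x, phi (phi x), ...). *)
Definition dlim : lmodType R :=
  quotm (comap (@submv _ _ compatible) eventually0).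

End DirectLimit.

Section LocalCohomology.
Variables (R : comPzRingType) (a : submodClosed R^o) (M : lmodType R).

Lemma expi_homo (n : nat) :
  {homo @idfun R^o : x / x \in expi a n.+1 >-> x \in expi a n}.
Proof.
move=> x /asboolP; apply=> y /= [r [z [_ za ->]]].
exact: rpredZ.
Qed.

Definition quot_expi (n : nat) : lmodType R := quotm (expi a n).

Definition quot_expi_proj n : {linear quot_expi n.+1 -> quot_expi n} :=
  quotm_map (@expi_homo n).

(* The index is shifted so that the system starts with R/a. *)
Definition local_cohomology (i : nat) : lmodType R :=
  @dlim R (fun n => ext i (quot_expi n.+1) M)
    (fun n => ext_map i M (quot_expi_proj n.+1)).

End LocalCohomology.

Section Spectrum.
Variable R : comPzRingType.

(* The prime ideals of R.  The carrier is not a bundled [submodClosed R^o] since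
   the universe of that type is too large to form [set spec]; the coercion
   [spec_ideal] recovers the bundled ideal. *)
Record spec := Spec {
  spec_mem : R^o -> bool;
  spec_closed : submod_closed spec_mem;
  spec_proper : ~~ spec_mem 1;
  spec_prime : forall x y : R, spec_mem (x * y) -> spec_mem x || spec_mem y
}.

HB.instance Definition _ (p : spec) :=
  GRing.isSubmodClosed.Build R R^o (spec_mem p) (spec_closed p).

Definition spec_ideal (p : spec) : submodClosed R^o :=
  (spec_mem p : {pred R^o}).
Coercion spec_ideal : spec >-> GRing.SubmodClosed.type.

Lemma spec_ext (p q : spec) : p =i q -> p = q.
Proof.
case: p q => [f ? ? ?] [g ? ? ?] fg.
have e : f = g by apply/funext => x; exact: fg.
by subst g; congr Spec; exact: Prop_irrelevance.
Qed.

Definition noetherian := forall I : submodClosed R^o, finitely_generated I.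

Definition krull_dim : \bar int :=
  supremum -oo%E [set k%:Z%:E | k in [set k : nat |
    exists c : nat -> spec, forall i, (i < k)%N ->
      {subset c i <= c i.+1} /\ ~ {subset c i.+1 <= c i}]].

End Spectrum.

Section QuotientRing.
Variables (R : comPzRingType) (I : submodClosed R^o).

Definition qring := quotm I.
HB.instance Definition _ := GRing.Zmodule.on qring.

Definition qring_mul (x y : qring) : qring :=
  quotm_pi I ((repr x : R) * (repr y : R)).

Lemma qring_mulE (x y : R) :
  qring_mul (quotm_pi I x) (quotm_pi I y) = quotm_pi I (x * y : R).
Proof.
apply/quotm_eqP.
set x' := repr _; set y' := repr _.
have -> : (x' : R) * (y' : R) - x * y = (x' : R) *: (y' - y : R^o) + (y : R) *: (x' - x : R^o) :> R.
  by rewrite /GRing.scale/= !mulrBr addrA [y * x']mulrC subrK [y * x]mulrC.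
by rewrite rpredD ?rpredZ ?repr_quotm.
Qed.

Lemma qring_mulA : associative qring_mul.
Proof. by do 3!elim/quotmW=> ?; rewrite !qring_mulE mulrA. Qed.
Lemma qring_mulC : commutative qring_mul.
Proof. by do 2!elim/quotmW=> ?; rewrite !qring_mulE mulrC. Qed.
Lemma qring_mul1 : left_id (quotm_pi I (1 : R)) qring_mul.
Proof. by elim/quotmW=> ?; rewrite !qring_mulE mul1r. Qed.
Lemma qring_mulDl : left_distributive qring_mul +%R.
Proof.
by do 3!elim/quotmW=> ?; rewrite -linearD !qring_mulE mulrDl linearD.
Qed.
HB.instance Definition _ := GRing.Zmodule_isComPzRing.Build qring
  qring_mulA qring_mulC qring_mul1 qring_mulDl.
End QuotientRing.

Section Localization.
Variables (R : comPzRingType) (p : spec R).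

Definition denom := {s : R | s \notin (p : {pred R})}.

Lemma denom_mul_subproof (s t : denom) : val s * val t \notin (p : {pred R}).
Proof.
apply/negP => /(@spec_prime _ p); apply/negP.
by rewrite negb_or (valP s) (valP t).
Qed.
Definition dmul (s t : denom) : denom := 
  exist (fun r : R => r \notin (p : {pred R})) _ (denom_mul_subproof s t).
Definition done1 : denom := 
  exist (fun r : R => r \notin (p : {pred R})) 1 (spec_proper p).

Section Module.
Variable M : lmodType R.

Definition loc_equiv (x y : M * denom) : bool :=
  `[< exists u : denom, val u *: (val y.2 *: x.1) = val u *: (val x.2 *: y.1) >].

Lemma loc_equivP : equiv_class_of loc_equiv.
Proof.
split=> [x|x y|y x z].
- by apply/asboolP; exists done1.
- by apply/idP/idP => /asboolP[u e]; apply/asboolP; exists u.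
move=> /asboolP[u e] /asboolP[v f]; apply/asboolP.
exists (dmul (dmul u v) y.2) => /=.
have {}e : val u * val y.2 *: x.1 = val u * val x.2 *: y.1 by rewrite -!scalerA.
have {}f : val v * val z.2 *: y.1 = val v * val y.2 *: z.1 by rewrite -!scalerA.
rewrite !scalerA.
have -> : val u * val v * val y.2 * val z.2 = (val v * val z.2) * (val u * val y.2).
  by rewrite mulrACA [val u * val v]mulrC -!mulrA [val y.2 * _]mulrC.
rewrite -scalerA e scalerA.
have -> : val v * val z.2 * (val u * val x.2) = (val u * val x.2) * (val v * val z.2).
  by rewrite mulrC.
rewrite -scalerA f scalerA; congr (_ *: _).
by rewrite mulrACA -!mulrA [val y.2 * _]mulrC.
Qed.

Canonical loc_equiv_rel := EquivRelPack loc_equivP.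
Canonical loc_encModRel := defaultEncModRel loc_equiv.

(* The localization M_p as an abelian group; [locring] below is R_p, and [locmod]
   is M_p with its R_p-module structure.  [frac m s] is m / s. *)
Definition loc := {eq_quot loc_equiv}.
HB.instance Definition _ := Choice.on loc.
HB.instance Definition _ : EqQuotient (M * denom)%type loc_equiv loc :=
  EqQuotient.on loc.

Definition frac (m : M) (s : denom) : loc := \pi_loc (m, s).

Lemma frac_eqP m s m' s' : frac m s = frac m' s' <->
  exists u : denom, val u *: (val s' *: m) = val u *: (val s *: m').
Proof. by split=> [/eqmodP/asboolP|?] //; apply/eqmodP/asboolP. Qed.

Lemma locW (P : loc -> Prop) : (forall m s, P (frac m s)) -> forall x, P x.
Proof. by move=> Pf x; rewrite -[x]reprK; case: (repr x) => m s; apply: Pf. Qed.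

Lemma frac_repr x : frac (repr x).1 (repr x).2 = x.
Proof. by rewrite /frac -surjective_pairing reprK. Qed.

Lemma frac_cancel t m s : frac (val t *: m) (dmul t s) = frac m s.
Proof. by apply/frac_eqP; exists done1; rewrite !scalerA /=; congr (_ *: _) => /=; ring. Qed.

Definition loc_add (x y : loc) : loc :=
  frac (val (repr y).2 *: (repr x).1 + val (repr x).2 *: (repr y).1)
       (dmul (repr x).2 (repr y).2).
Definition loc_opp (x : loc) : loc := frac (- (repr x).1) (repr x).2.

Lemma loc_addE m s m' s' : loc_add (frac m s) (frac m' s') =
  frac (val s' *: m + val s *: m') (dmul s s').
Proof.
have /frac_eqP[u eu] := frac_repr (frac m s).
have /frac_eqP[v ev] := frac_repr (frac m' s').
rewrite /loc_add; move: (repr (frac m s)) (repr (frac m' s')) eu ev => [n t] [n' t'] /= eu ev.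
apply/frac_eqP; exists (dmul u v) => /=; rewrite !scalerDr !scalerA.
move: eu ev; rewrite !scalerA => eu ev; congr (_ + _).
  transitivity ((val v * val s' * val t') *: ((val u * val s) *: n)).
  by rewrite scalerA; congr (_ *: _) => /=; ring.
  by rewrite eu scalerA; congr (_ *: _) => /=; ring.
transitivity ((val u * val s * val t) *: ((val v * val s') *: n')).
  by rewrite scalerA; congr (_ *: _) => /=; ring.
by rewrite ev scalerA; congr (_ *: _) => /=; ring.
Qed.

Lemma loc_oppE m s : loc_opp (frac m s) = frac (- m) s.
Proof.
have /frac_eqP[u eu] := frac_repr (frac m s).
by apply/frac_eqP; exists u; rewrite !scalerN eu.
Qed.

Lemma loc_addEc m m' s : loc_add (frac m s) (frac m' s) = frac (m + m') s.
Proof. by rewrite loc_addE -scalerDr frac_cancel. Qed.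

Lemma frac0 s : frac 0 s = frac 0 done1.
Proof. by apply/frac_eqP; exists done1; rewrite !scaler0. Qed.

Lemma frac_common2 x y : exists m m' s, x = frac m s /\ y = frac m' s.
Proof.
elim/locW: x => m s; elim/locW: y => m' s'.
exists (val s' *: m), (val s *: m'), (dmul s' s).
rewrite frac_cancel; split=> //.
have -> : dmul s' s = dmul s s' by apply: val_inj; rewrite /= mulrC.
by rewrite frac_cancel.
Qed.

Lemma frac_common3 x y z :
  exists m m' m'' s, [/\ x = frac m s, y = frac m' s & z = frac m'' s].
Proof.
have [m [m' [s [-> ->]]]] := frac_common2 x y; elim/locW: z => m'' t.
exists (val t *: m), (val t *: m'), (val s *: m''), (dmul t s).
rewrite !frac_cancel; split=> //.
have -> : dmul t s = dmul s t by apply: val_inj; rewrite /= mulrC.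
by rewrite frac_cancel.
Qed.

Lemma loc_addA : associative loc_add.
Proof.
move=> x y z; have [m [m' [m'' [s [-> -> ->]]]]] := frac_common3 x y z.
by rewrite !loc_addEc addrA.
Qed.
Lemma loc_addC : commutative loc_add.
Proof.
move=> x y; have [m [m' [s [-> ->]]]] := frac_common2 x y.
by rewrite !loc_addEc addrC.
Qed.
Lemma loc_add0 : left_id (frac 0 done1) loc_add.
Proof. by elim/locW=> m s; rewrite -(frac0 s) loc_addEc add0r. Qed.
Lemma loc_addN : left_inverse (frac 0 done1) loc_opp loc_add.
Proof. by elim/locW=> m s; rewrite loc_oppE loc_addEc addNr frac0. Qed.
HB.instance Definition _ := GRing.isZmodule.Build loc
  loc_addA loc_addC loc_add0 loc_addN.

End Module.

Section Scale.
Variable M : lmodType R.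

Definition loc_scale (a : loc R^o) (x : loc M) : loc M :=
  frac (((repr a).1 : R) *: (repr x).1) (dmul (repr a).2 (repr x).2).

Lemma loc_scaleE (r : R) s (m : M) t :
  loc_scale (frac (r : R^o) s) (frac m t) = frac (r *: m) (dmul s t).
Proof.
have /frac_eqP[u eu] := frac_repr (frac (r : R^o) s).
have /frac_eqP[v ev] := frac_repr (frac m t).
rewrite /loc_scale; move: (repr (frac (r : R^o) s)) (repr (frac m t)) eu ev => [r' s'] [m' t'] /= eu ev.
apply/frac_eqP; exists (dmul u v) => /=; rewrite !scalerA.
have {}eu : val u * (val s * (r' : R)) = val u * (val s' * r) := eu.
move: ev; rewrite !scalerA => ev.
transitivity ((val u * (val s * r')) *: ((val v * val t) *: m')).
  by rewrite scalerA; congr (_ *: _) => /=; ring.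
by rewrite eu ev scalerA; congr (_ *: _) => /=; ring.
Qed.
End Scale.

Definition locring := loc R^o.
HB.instance Definition _ := GRing.Zmodule.on locring.

Definition locring_mul (a b : locring) : locring := loc_scale a b.

Lemma dmulA s t u : dmul s (dmul t u) = dmul (dmul s t) u.
Proof. by apply: val_inj; rewrite /= mulrA. Qed.
Lemma dmulC s t : dmul s t = dmul t s.
Proof. by apply: val_inj; rewrite /= mulrC. Qed.
Lemma dmul1 s : dmul done1 s = s.
Proof. by apply: val_inj; rewrite /= mul1r. Qed.

Lemma locring_mulE (x : R) s (y : R) t :
  locring_mul (@frac R^o x s) (@frac R^o y t) = @frac R^o (x * y) (dmul s t).
Proof. exact: loc_scaleE. Qed.

Lemma locring_mulA : associative locring_mul.
Proof.
elim/locW=> x s; elim/locW=> y t; elim/locW=> z u.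
by rewrite !locring_mulE dmulA mulrA.
Qed.
Lemma locring_mulC : commutative locring_mul.
Proof.
elim/locW=> x s; elim/locW=> y t.
by rewrite !locring_mulE dmulC mulrC.
Qed.
Lemma locring_mul1 : left_id (frac (1 : R^o) done1) locring_mul.
Proof. by elim/locW=> ? ?; rewrite /locring_mul loc_scaleE dmul1 scale1r. Qed.
Lemma locring_mulDl : left_distributive locring_mul +%R.
Proof.
move=> a' b' c; have [a [b [s [-> ->]]]] := frac_common2 a' b'.
elim/locW: c => c t.
by rewrite [_ + _]loc_addEc /locring_mul !loc_scaleE [RHS]loc_addEc scalerDl.
Qed.
HB.instance Definition _ := GRing.Zmodule_isComPzRing.Build locring
  locring_mulA locring_mulC locring_mul1 locring_mulDl.

Section LModule.
Variable M : lmodType R.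

Definition locmod := loc M.
HB.instance Definition _ := GRing.Zmodule.on locmod.

Lemma locmod_scaleA (a b : locring) (x : locmod) :
  loc_scale a (loc_scale b x) = loc_scale (a * b) x.
Proof.
elim/locW: a => a s; elim/locW: b => b t; elim/locW: x => x u.
by rewrite [_ * _]locring_mulE (loc_scaleE b t x u) !loc_scaleE scalerA dmulA.
Qed.
Lemma locmod_scale1 : left_id (1 : locring) (@loc_scale M).
Proof. by elim/locW=> x s; rewrite loc_scaleE scale1r dmul1. Qed.
Lemma locmod_scaleDr : right_distributive (@loc_scale M) +%R.
Proof.
move=> a x' y'; have [x [y [s [-> ->]]]] := frac_common2 x' y'.
elim/locW: a => a t.
by rewrite [_ + _]loc_addEc !loc_scaleE [RHS]loc_addEc scalerDr.
Qed.
Lemma locmod_scaleDl (x : locmod) :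
  {morph (@loc_scale M)^~ x : a b / (a : locring) + b >-> a + b}.
Proof.
move=> a' b'; have [a [b [s [-> ->]]]] := frac_common2 a' b'.
elim/locW: x => x t.
by rewrite [_ + _]loc_addEc !loc_scaleE [RHS]loc_addEc scalerDl.
Qed.
HB.instance Definition _ := GRing.Zmodule_isLmodule.Build locring locmod
  locmod_scaleA locmod_scale1 locmod_scaleDr locmod_scaleDl.
End LModule.

Definition locideal (a : submodClosed R^o) : submodClosed locring^o :=
  span [set (@frac R^o r done1 : locring^o) | r in [set r : R | r \in a]].

End Localization.

Section FinitenessDimensions.
Variable R : comPzRingType.

Definition Ass (X : lmodType R) : set (spec R) :=
  [set p : spec R | exists x : X,
    forall r : R, r \in (p : {pred R}) <-> r *: x = 0].

Definition Supp (X : lmodType R) : set (spec R) :=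
  [set p : spec R | exists y : locmod p X, y != 0].

(* Dimensions and finiteness dimensions take values in [\bar int]: the supremum of
   the empty set is -oo and the infimum of the empty set is +oo. *)
Definition dim_quot (p : spec R) : \bar int := krull_dim (qring p).

Definition dim_ge (T : set (spec R)) (n : nat) : set (spec R) :=
  [set p | T p /\ (n%:Z%:E <= dim_quot p)%E].

Definition dim_Supp (X : lmodType R) : \bar int :=
  supremum -oo%E [set dim_quot p | p in Supp X].

Definition ideal_power_lc (a b : submodClosed R^o) (M : lmodType R) (t i : nat) :
    submodClosed (local_cohomology a M i) :=
  mulm (expi b t) (@topm R (local_cohomology a M i)).

(* f_a^b(M) *)
Definition findim (a b : submodClosed R^o) (M : lmodType R) : \bar int :=
  infimum +oo%E [set i%:Z%:E | i in [set i : nat |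
    forall t, (0 < t)%N ->
      exists2 x, x \in ideal_power_lc a b M t i & x != 0]].

(* f_a^b(M)_n *)
Definition findim_lower (a b : submodClosed R^o) (M : lmodType R) (n : nat) :
    \bar int :=
  infimum +oo%E [set i%:Z%:E | i in [set i : nat |
    forall t, (n%:Z%:E <= dim_Supp (subm (ideal_power_lc a b M t i)))%E]].

End FinitenessDimensions.

(* f_a^b(M)^n *)
Definition findim_upper (R : comPzRingType) (a b : submodClosed R^o)
    (M : lmodType R) (n : nat) : \bar int :=
  infimum +oo%E [set findim (locideal p a) (locideal p b) (locmod p M) |
    p in [set p : spec R | (n%:Z%:E <= dim_quot p)%E]].

(* Main.v *)
Require Import Defs.
From HB Require Import structures.
From mathcomp Require Import all_boot all_order all_algebra.
From mathcomp Require Import ring zify boolp classical_sets functions cardinality.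
From mathcomp Require Import constructive_ereal.
(* Imported last so that free, lift, frac, span and hom mean the notions of the
   statement and not those of the algebra library. *)
Require Import Defs.

(** Write H for the i-th local cohomology module of M. Everything follows from the
    compatibility of H with localization in the form [Supp_ideal_power_lc]: p lies
    in the support of b^t H if and only if b_p^t does not annihilate the local
    cohomology of M_p. Thus the finiteness dimension at p is the least i for which p
    supports b^t H for every t, and when the dimension of R/p is at least n such an
    i is a candidate in the definition of the lower dimension. Conversely let i be
    the lower dimension and suppose that each p of dimension at least n is missed by
    the support of b^t H for some t depending on p. The associated primes of H of
    dimension at least n are finitely many, so one t serves for all of them. The
    support of b^t H still has a prime of dimension at least n; below it there is an
    associated prime of b^t H ([Supp_Ass]), whose dimension is no smaller
    ([dim_quot_antitone]) and which is associated to H. This is a contradiction.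

    Localization of Ext needs care because Ext is computed from canonical
    resolutions, free on all elements of the successive syzygies, which in general
    are neither finitely generated nor compatible with localization term by term. By
    [ext_class_onto] and [extS_class_eq0] the group Ext^(i+1)(N, M) consists of the
    maps from the (i+1)-st syzygy of N to M, modulo those that extend to the free
    module around that syzygy. The groups over R and over R_p are compared through
    the zigzag

      Ext_R(N, M) -> Ext_R(N, M_p) <- Ext_(R_p)(N_p, M_p),

    which is natural in N and so passes to the limit defining local cohomology. The
    left map has torsion kernel and cokernel ([ext_loc_in_torsion],
    [ext_loc_in_onto]), since the syzygies of N are finitely generated up to maps
    that factor through free modules. The right map is bijective
    ([base_ext_class_inj], [base_ext_class_onto]), since the syzygies over R_p are
    the localized ones up to such maps. Both stable statements go from one syzygy to
    the next by the same short argument, [stable_ses]. *)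

Set Implicit Arguments.
Unset Strict Implicit.
Unset Printing Implicit Defensive.

Import Order.TTheory GRing.Theory.

Local Open Scope classical_set_scope.
Local Open Scope ring_scope.

(** * Linear maps, short exact sequences, stable triviality *)

Section LinearMaps.
Variable R : comPzRingType.

Lemma linear_pack (U V : lmodType R) (f : U -> V) : linear f ->
  exists g : {linear U -> V}, g =1 f.
Proof.
move=> lf.
pose m := GRing.isLinear.Build R U V *:%R f lf.
pose g : {linear U -> V} := HB.pack f m.
by exists g.
Qed.

Lemma submv_onto (V : lmodType R) (N : submodClosed V) x : x \in N ->
  exists y : subm N, submv y = x.
Proof. by move=> Nx; exists (exist _ x Nx). Qed.

Lemma submv_mem (V : lmodType R) (N : submodClosed V) (x : subm N) : submv x \in N.
Proof. exact: valP. Qed.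

Lemma kermE (U V : lmodType R) (f : {linear U -> V}) x : x \in kerm f <-> f x = 0.
Proof. by split=> [/eqP|fx]; last apply/eqP. Qed.

Lemma free_lift (X : choiceType) (V : lmodType R) (g : X -> V) :
  exists h : {linear free X -> V}, forall x, h (gen R x) = g x.
Proof. by exists (lift g) => x; exact: lift_gen. Qed.

Definition onto (U V : lmodType R) (f : {linear U -> V}) :=
  forall y, exists x, f x = y.

Lemma onto_aug (N : lmodType R) : onto (aug N).
Proof. by move=> y; exists (gen R y); exact: (lift_gen id). Qed.

(** Only the lifting property is ever used, and it holds for the localization of
    a free module without that module being free in the sense of [free]. *)
Definition projective (F : lmodType R) := forall (U V : lmodType R)
  (q : {linear U -> V}), onto q -> forall h : {linear F -> V},
  exists k : {linear F -> U}, forall u, q (k u) = h u.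

Lemma projective_free (X : choiceType) : projective (free X).
Proof.
move=> U V q qonto h.
have [g gE] := boolp.choice (fun x => qonto (h (gen R x))).
have [k kE] := free_lift g; exists k.
have [qk qkE] : exists qk : {linear free X -> V}, qk =1 q \o k by exists (q \o k).
by move=> u; rewrite -[q _]qkE; apply: lift_ext => x; rewrite qkE /= kE gE.
Qed.

Lemma factor_mono (K F U : lmodType R) (j : {linear K -> F}) (h : {linear U -> F}) :
  injective j -> (forall u, exists k, j k = h u) ->
  exists l : {linear U -> K}, forall u, j (l u) = h u.
Proof.
move=> injj /boolp.choice[l lE].
have /linear_pack[l' l'E] : linear l.
  by move=> a x y; apply: injj; rewrite lE !linearP !lE.
by exists l' => u; rewrite l'E.
Qed.

Lemma factor_epi (F S V : lmodType R) (q : {linear F -> S}) (h : {linear F -> V}) :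
  onto q -> (forall x, q x = 0 -> h x = 0) ->
  exists l : {linear S -> V}, forall x, l (q x) = h x.
Proof.
move=> qonto qh; have [r rE] := boolp.choice qonto.
have hr x : h (r (q x)) = h x.
  by apply/eqP; rewrite -subr_eq0 -linearB qh// linearB rE subrr.
have /linear_pack[l lE] : linear (h \o r).
  move=> a x y; rewrite -[x in LHS]rE -[y in LHS]rE -linearP /= hr.
  by rewrite linearP.
by exists l => x; rewrite lE /= hr.
Qed.

(** The short exact sequence 0 -> K -> F -> S -> 0, with K given up to isomorphism
    so that the localization of a kernel may stand for the kernel. *)
Record ses (K F S : lmodType R) (j : {linear K -> F}) (q : {linear F -> S}) : Prop :=
  Ses { ses_mono : injective j;
        ses_onto : onto q;
        ses_exact : forall x, q x = 0 <-> exists k, j k = x }.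

Lemma ses_comp0 (K F S : lmodType R) (j : {linear K -> F}) (q : {linear F -> S}) k :
  ses j q -> q (j k) = 0.
Proof. by move=> sesjq; apply/(ses_exact sesjq); exists k. Qed.

Lemma ses_kerm (F S : lmodType R) (q : {linear F -> S}) : onto q ->
  ses (@submv _ _ (kerm q)) q.
Proof.
move=> qonto; split; [exact: val_inj|exact: qonto|move=> x].
split=> [/kermE/submv_onto//|[k <-]].
by apply/kermE; exact: submv_mem.
Qed.

Definition ses_aug (S : lmodType R) : ses (@submv _ _ (kerm (aug S))) (aug S) :=
  ses_kerm (@onto_aug S).

Section Morphisms.
Variables (K F S K' F' S' : lmodType R).
Variables (j : {linear K -> F}) (q : {linear F -> S}).
Variables (j' : {linear K' -> F'}) (q' : {linear F' -> S'}).

Lemma ses_restrict (A : {linear F -> F'}) (f : S -> S') : ses j q -> ses j' q' ->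
  f 0 = 0 -> (forall x, q' (A x) = f (q x)) ->
  exists f1 : {linear K -> K'}, forall x, j' (f1 x) = A (j x).
Proof.
move=> sjq sjq' f0 qA.
apply: (factor_mono (h := A \o j)) => [|u /=]; first exact: ses_mono sjq'.
by apply/(ses_exact sjq'); rewrite qA ses_comp0.
Qed.

Lemma ses_lift (f : {linear S -> S'}) : projective F -> ses j q -> ses j' q' ->
  exists (A : {linear F -> F'}) (f1 : {linear K -> K'}),
    (forall x, q' (A x) = f (q x)) /\ (forall x, j' (f1 x) = A (j x)).
Proof.
move=> projF sjq sjq'.
have [A AE] := projF _ _ q' (ses_onto sjq') (f \o q).
have [f1 f1E] := ses_restrict sjq sjq' (linear0 f) AE.
by exists A, f1.
Qed.

End Morphisms.

(** The engine of both dimension shifts below.  Call an endomorphism t of S stably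
    trivial when id - t lifts to the cover F; the lift [w] is the data.  With T a
    lift of t to F, the map id - T - w q is killed by q, hence lands in K, and on K
    it is id - T since q vanishes there: so id - t1 extends from K to F.  As F is
    projective, the extension lifts again to any cover of K, so that the property
    passes from S to its syzygy. *)
Lemma stable_ses (K F S : lmodType R) (j : {linear K -> F}) (q : {linear F -> S})
    (t : S -> S) (w : {linear S -> F}) (T : {linear F -> F}) (t1 : {linear K -> K}) :
  ses j q -> (forall x, q (w x) = x - t x) ->
  (forall x, q (T x) = t (q x)) -> (forall x, j (t1 x) = T (j x)) ->
  exists v : {linear F -> K}, forall x, v (j x) = x - t1 x.
Proof.
move=> sjq wE TE t1E.
have [h hE] : exists h : {linear F -> F}, forall x, h x = x - T x - w (q x).
  by exists (idfun \- T \- (w \o q)).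
have [|v vE] := factor_mono (ses_mono sjq) (h := h).
  by move=> u; apply/(ses_exact sjq); rewrite hE !linearB TE wE subrr.
exists v => x; apply: (ses_mono sjq).
by rewrite vE hE linearB t1E (ses_comp0 _ sjq) linear0 subr0.
Qed.

End LinearMaps.

(** * Ext classes as maps out of syzygies *)

Section ExtClasses.
Variable R : comPzRingType.
Implicit Types (N M : lmodType R).

Lemma cochain_of_subproof i N M (f : {linear syzn i N -> M}) :
  f \o aug (syzn i N) \in hom (res i N) M.
Proof. by apply/asboolP => a x y /=; rewrite !linearP. Qed.

Definition cochain_of i N M (f : {linear syzn i N -> M}) : cochain i N M :=
  exist _ (f \o aug (syzn i N)) (cochain_of_subproof f).

Lemma cochain_of_cocycle i N M (f : {linear syzn i N -> M}) :
  cochain_of f \in cocycle i N M.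
Proof.
rewrite comapE; apply/eqP/val_inj/funext => u.
rewrite /= /precomp /=.
by have /eqP-> := valP (aug (syzn i.+1 N) u); rewrite linear0.
Qed.

Definition cocycle_of i N M (f : {linear syzn i N -> M}) : subm (cocycle i N M) :=
  exist _ (cochain_of f) (cochain_of_cocycle f).

(** A cocycle on the free module over syzn i N is a map that vanishes on the
    relations, that is, a map f on syzn i N composed with the augmentation. *)
Definition ext_class i N M (f : {linear syzn i N -> M}) : ext i N M :=
  quotm_pi (comap (@submv _ _ (cocycle i N M)) (coboundary i N M)) (cocycle_of f).

Lemma ext_class_onto i N M (x : ext i N M) : exists f, x = ext_class f.
Proof.
elim/quotmW: x => -[[u lu] du].
have /linear_pack[h hE] : linear u by move: (lu) => /asboolP.
have uE : forall z, u (submv (aug (syzn i.+1 N) z)) = 0.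
  move=> z; have /eqP/(congr1 val)/= := du.
  by move=> /(congr1 (fun g => g z)).
have [|f fE] := factor_epi (h := h) (@onto_aug _ (syzn i N)).
  move=> z /(ses_exact (ses_aug _))[y <-]; rewrite hE.
  by have [v <-] := @onto_aug R (syzn i.+1 N) y; exact: uE.
exists f; congr quotm_pi; apply: val_inj; apply: val_inj.
by apply/funext => z /=; rewrite fE hE.
Qed.

Lemma ext_class_linear i N M a (f g h : {linear syzn i N -> M}) :
  (forall u, h u = a *: f u + g u) ->
  ext_class h = a *: ext_class f + ext_class g.
Proof.
move=> hE; rewrite /ext_class -linearP; congr quotm_pi.
by do 2!apply: val_inj; apply/funext => z /=; rewrite hE.
Qed.

Lemma eq_ext_class i N M (f g : {linear syzn i N -> M}) :
  f =1 g -> ext_class f = ext_class g.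
Proof.
move=> fg; congr quotm_pi.
by do 2!apply: val_inj; apply/funext => z /=; rewrite fg.
Qed.

Lemma ext_class0 i N M (f : {linear syzn i N -> M}) : ext_class f = 0 <->
  cochain_of f \in coboundary i N M.
Proof.
rewrite -[0](linear0 (quotm_pi _)); split=> [/quotm_eqP|fb].
  by rewrite subr0 comapE.
by apply/quotm_eqP; rewrite subr0 comapE.
Qed.

Lemma ext0_class_eq0 N M (f : {linear syzn 0 N -> M}) :
  ext_class f = 0 <-> forall u, f u = 0.
Proof.
split=> [/ext_class0/eqP f0 u|f0].
  have [v <-] := onto_aug u.
  by have /= := congr1 (fun g => val g v) f0.
by apply/ext_class0/eqP; apply: val_inj; apply/funext => z /=; rewrite f0.
Qed.

(** Coboundaries are the maps that extend from the syzygy to the free module in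
    which it lies: Ext^(i+1)(N, M) is Hom(syzn i.+1 N, M) modulo such maps. *)
Lemma extS_class_eq0 i N M (f : {linear syzn i.+1 N -> M}) :
  ext_class f = 0 <-> exists g : {linear res i N -> M}, forall u, f u = g (val u).
Proof.
split=> [/ext_class0/asboolP[[g lg] /(congr1 val)/= fE]|[g gE]].
  have /linear_pack[h hE] : linear g by move: (lg) => /asboolP.
  exists h => u; have [v <-] := onto_aug u.
  have := congr1 (fun h => h v) fE.
  by rewrite /= hE.
apply/ext_class0/asboolP.
have lg : (g : res i N -> M) \in hom (res i N) M.
  by apply/asboolP => a x y; rewrite linearP.
exists (exist _ (g : res i N -> M) lg).
by apply: val_inj; apply/funext => z /=; rewrite gE.
Qed.

Lemma ext_classZ i N M a (f h : {linear syzn i N -> M}) :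
  (forall u, h u = a *: f u) -> ext_class h = a *: ext_class f.
Proof.
move=> hE; have e : ext_class (\0 : {linear syzn i N -> M}) = 0.
  have := @ext_class_linear i N M (-1) \0 \0 \0.
  by rewrite scaleN1r addNr; apply=> u; rewrite /= scaler0 addr0.
by rewrite (@ext_class_linear i N M a f \0) ?e ?addr0// => u; rewrite hE /= addr0.
Qed.

(** The form in which a stable triviality is applied to cohomology classes. *)
Lemma eq_extS_class i N M (f g : {linear syzn i.+1 N -> M})
    (G : {linear res i N -> M}) :
  (forall u, f u = g u + G (val u)) -> ext_class f = ext_class g.
Proof.
move=> fE; have e : ext_class (G \o @submv _ _ _ : {linear syzn i.+1 N -> M}) = 0.
  by apply/extS_class_eq0; exists G.
rewrite (ext_class_linear (a := 1) (f := g) (g := G \o @submv _ _ _)) ?e ?scale1r ?addr0//.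
by move=> u; rewrite fE scale1r.
Qed.

Lemma ext_map_class i N N' M (h : {linear N -> N'}) (f : {linear syzn i N' -> M}) :
  ext_map i M h (ext_class f) = ext_class (f \o syzn_map i h).
Proof.
apply: etrans; first exact: (quotm_mapE (@ext_map_subproof R i N N' M h)).
congr quotm_pi; do 2!apply: val_inj; apply/funext => z /=.
by rewrite /precomp /= aug_natural.
Qed.

End ExtClasses.

(** * Localization and restriction of scalars *)

Section Localization.
Variables (R : comPzRingType) (p : spec R).

Definition of_base (r : R) : locring p := @frac R p R^o r (done1 p).

Lemma of_baseM r s : of_base (r * s) = of_base r * of_base s.
Proof. by rewrite [RHS]locring_mulE dmul1. Qed.

Lemma of_baseD r s : of_base (r + s) = of_base r + of_base s.
Proof. by rewrite [RHS]loc_addEc. Qed.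

Lemma of_base1 : of_base 1 = 1.
Proof. by []. Qed.

Definition den (s : denom p) : locring p := of_base (val s).
Definition den_inv (s : denom p) : locring p := @frac R p R^o 1 s.

Lemma denK s : den_inv s * den s = 1.
Proof.
rewrite [LHS]locring_mulE; apply/(@frac_eqP R p R^o); exists (done1 p).
by rewrite /= !scale1r /GRing.scale /= !mulr1 mul1r.
Qed.

Lemma denM s t : den (dmul s t) = den s * den t.
Proof. exact: of_baseM. Qed.

Lemma den_scaleK (V : lmodType (locring p)) s (v : V) : den_inv s *: (den s *: v) = v.
Proof. by rewrite scalerA denK scale1r. Qed.

Lemma den_scale_inj (V : lmodType (locring p)) s (v w : V) :
  den s *: v = den s *: w -> v = w.
Proof. by move=> /(congr1 ( *:%R (den_inv s))); rewrite !den_scaleK. Qed.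

Lemma locring_den (a : locring p) : exists s r, den s * a = of_base r.
Proof.
elim/(@locW R p R^o): a => r s; exists s, r; rewrite [LHS]locring_mulE dmul1.
by rewrite /of_base -(@frac_cancel R p R^o s r (done1 p)) dmulC dmul1.
Qed.

(** Restriction of scalars along R -> R_p. *)
Definition restr (V : lmodType (locring p)) : Type := V.
HB.instance Definition _ (V : lmodType (locring p)) := GRing.Zmodule.on (restr V).

Section Restr.
Variable V : lmodType (locring p).

Definition restr_scale (r : R) (v : restr V) : restr V := of_base r *: (v : V).
Lemma restr_scaleA a b v : restr_scale a (restr_scale b v) = restr_scale (a * b) v.
Proof. by rewrite /restr_scale scalerA of_baseM. Qed.
Lemma restr_scale1 : left_id 1 restr_scale.
Proof. by move=> v; rewrite /restr_scale of_base1 scale1r. Qed.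
Lemma restr_scaleDr : right_distributive restr_scale +%R.
Proof. by move=> r v w; exact: scalerDr. Qed.
Lemma restr_scaleDl v : {morph restr_scale^~ v : a b / a + b}.
Proof. by move=> r s; rewrite /restr_scale of_baseD; exact: scalerDl. Qed.
HB.instance Definition _ := GRing.Zmodule_isLmodule.Build R (restr V)
  restr_scaleA restr_scale1 restr_scaleDr restr_scaleDl.

Lemma restr_den (s : denom p) (v : V) : val s *: (v : restr V) = den s *: v :> V.
Proof. by []. Qed.

Lemma restr_linearZ (S : lmodType R) (g : {linear S -> restr V}) r x :
  g (r *: x) = of_base r *: (g x : V) :> V.
Proof. exact: linearZ_LR. Qed.
End Restr.

Section RestrMap.
Variables (U V : lmodType (locring p)) (f : {linear U -> V}).
Definition restr_map : restr U -> restr V := f.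
Lemma restr_map_linear : linear restr_map.
Proof. by move=> a x y; rewrite /restr_map; exact: (linearP f). Qed.
HB.instance Definition _ := GRing.isLinear.Build R (restr U) (restr V) _
  restr_map restr_map_linear.
End RestrMap.

Definition loc_in (M : lmodType R) (x : M) : restr (locmod p M) :=
  frac x (done1 p).
Lemma loc_in_linear (M : lmodType R) : linear (@loc_in M).
Proof.
move=> a x y.
transitivity (loc_add (loc_scale (@frac R p R^o a (done1 p)) (frac x (done1 p)))
  (frac y (done1 p))); last by [].
by rewrite loc_scaleE dmul1 loc_addEc.
Qed.
HB.instance Definition _ M := GRing.isLinear.Build R M (restr (locmod p M)) _
  (@loc_in M) (@loc_in_linear M).

Lemma loc_inZ (M : lmodType R) r (x : M) :
  loc_in (r *: x) = of_base r *: (loc_in x : locmod p M) :> locmod p M.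
Proof. exact: (@restr_linearZ (locmod p M) M (@loc_in M)). Qed.

Lemma loc_inD (M : lmodType R) (x y : M) :
  loc_in (x + y) = (loc_in x : locmod p M) + loc_in y :> locmod p M.
Proof. exact: (linearD (@loc_in M)). Qed.

Lemma frac_loc_in (M : lmodType R) (x : M) s :
  den s *: (frac x s : locmod p M) = loc_in x.
Proof.
rewrite -[LHS]/(loc_scale _ _) loc_scaleE dmul1.
by rewrite /loc_in -(frac_cancel s x (done1 p)) dmulC dmul1.
Qed.

Lemma loc_den (M : lmodType R) (y : locmod p M) :
  exists s x, den s *: y = loc_in x.
Proof. by elim/locW: y => x s; exists s, x; exact: frac_loc_in. Qed.

Lemma loc_in_eq0 (M : lmodType R) (x : M) :
  loc_in x = 0 <-> exists s : denom p, val s *: x = 0.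
Proof.
split=> [|[s sx]].
  move=> /(@frac_eqP R p M)[u]; rewrite !scale1r scaler0 => ux; by exists u.
by apply: (@den_scale_inj _ s); rewrite -restr_den -linearZ /= sx linear0 scaler0.
Qed.

Lemma loc_in_eq (M : lmodType R) (x y : M) :
  loc_in x = loc_in y <-> exists s : denom p, val s *: x = val s *: y.
Proof.
split=> [xy|[s sxy]].
  have /loc_in_eq0[s] : loc_in (x - y) = 0 by rewrite linearB /= xy subrr.
  by rewrite scalerBr => /eqP; rewrite subr_eq0 => /eqP; exists s.
apply/eqP; rewrite -subr_eq0 -linearB; apply/eqP/loc_in_eq0; exists s.
by rewrite scalerBr sxy subrr.
Qed.

End Localization.

Section LocalizationFunctor.
Variables (R : comPzRingType) (p : spec R).

Lemma loc_hom_ext (S : lmodType R) (V : lmodType (locring p))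
    (k k' : {linear locmod p S -> V}) :
  (forall x, k (loc_in p x) = k' (loc_in p x)) -> k =1 k'.
Proof.
move=> kk' y; have [s [x sy]] := loc_den y.
by apply: (@den_scale_inj _ _ _ s); rewrite -!linearZ sy kk'.
Qed.

(** Universal property of M_p.  The value at y is pinned down by the condition that
    it be compatible with every way of clearing the denominator of y. *)
Lemma loc_lift (S : lmodType R) (V : lmodType (locring p)) (g : {linear S -> restr V}) :
  exists k : {linear locmod p S -> V}, forall x, k (loc_in p x) = g x.
Proof.
pose P (y : locmod p S) (v : V) :=
  forall s x, den s *: y = loc_in p x -> den s *: v = g x.
have /boolp.choice[k kP] y : exists v, P y v.
  have [s [x sy]] := loc_den y; exists (den_inv s *: (g x : V)) => t z ty.
  have : loc_in p (val t *: x) = loc_in p (val s *: z).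
    by rewrite !loc_inZ -sy -ty !scalerA -!of_baseM mulrC.
  move=> /loc_in_eq[u /(congr1 g)]; rewrite !restr_linearZ.
  move=> /den_scale_inj e; apply: (@den_scale_inj _ _ _ s).
  by rewrite -e !scalerA [X in X * _]mulrC -mulrA [X in _ * X]mulrC denK mulr1.
have kin x : k (loc_in p x) = g x.
  have := kP (loc_in p x) (done1 p) x.
  by rewrite /den of_base1 !scale1r; apply.
have /linear_pack[l lE] : linear k.
  move=> a y z.
  have [s [x sy]] := loc_den y; have [t [w tz]] := loc_den z.
  have [c [r ca]] := locring_den a.
  have key : den (dmul c (dmul s t)) *: (a *: y + z) =
      loc_in p ((r * val t) *: x + (val c * val s) *: w).
    rewrite loc_inD !loc_inZ.
    rewrite -sy -tz scalerDr !denM.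
    rewrite !of_baseM -ca !scalerA.
    by congr (_ *: _ + _ *: _); rewrite /den; ring.
  apply: (den_scale_inj (s := dmul c (dmul s t))).
  rewrite (kP _ _ _ key) (linearD g) !restr_linearZ -(kP _ _ _ sy) -(kP _ _ _ tz).
  rewrite scalerDr !denM !of_baseM -ca !scalerA.
  by congr (_ *: _ + _ *: _); rewrite /den; ring.
by exists l => x; rewrite lE kin.
Qed.

Lemma loc_map (S T : lmodType R) (h : {linear S -> T}) :
  exists k : {linear locmod p S -> locmod p T},
    forall x, k (loc_in p x) = loc_in p (h x).
Proof. exact: (loc_lift (@loc_in R p T \o h)). Qed.

Lemma loc_lin0 (U V : lmodType (locring p)) (f : {linear U -> V}) s u :
  f (den s *: u) = 0 -> f u = 0.
Proof.
rewrite linearZ /= => e; apply: (@den_scale_inj _ _ _ s).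
by rewrite e scaler0.
Qed.

Lemma loc_ses (K F S : lmodType R) (j : {linear K -> F}) (q : {linear F -> S})
    (jp : {linear locmod p K -> locmod p F}) (qp : {linear locmod p F -> locmod p S}) :
  (forall x, jp (loc_in p x) = loc_in p (j x)) ->
  (forall x, qp (loc_in p x) = loc_in p (q x)) -> ses j q -> ses jp qp.
Proof.
move=> jpE qpE sjq; split.
- apply: raddf_inj => y; have [s [x sy]] := loc_den y.
  move=> /(congr1 ( *:%R (den s))); rewrite scaler0 -linearZ sy jpE.
  move=> /(@loc_in_eq0 R p)[u]; rewrite -linearZ -[RHS](linear0 j) => /(ses_mono sjq) ux.
  apply: (@den_scale_inj _ _ _ s); rewrite sy scaler0.
  by apply/(@loc_in_eq0 R p); exists u.
- move=> y; have [s [x sy]] := loc_den y; have [z qz] := ses_onto sjq x.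
  exists (den_inv s *: loc_in p z).
  by rewrite linearZ /= qpE qz -sy den_scaleK.
move=> y; split=> [|[k <-]].
  have [s [x sy]] := loc_den y.
  move=> /(congr1 ( *:%R (den s))); rewrite scaler0 -linearZ sy qpE.
  move=> /(@loc_in_eq0 R p)[u]; rewrite -linearZ => /(ses_exact sjq)[k jk].
  exists (den_inv s *: (den_inv u *: loc_in p k)).
  by rewrite !linearZ jpE jk linearZ /= restr_den den_scaleK -sy den_scaleK.
have [s [x sk]] := loc_den k; apply: (@loc_lin0 _ _ qp s); rewrite -linearZ sk.
by rewrite jpE qpE (ses_comp0 _ sjq) linear0.
Qed.

(** A lift needs to be chosen on the generators only. *)
Lemma loc_projective_free (X : choiceType) : projective (locmod p (@free R X)).
Proof.
move=> U V q qonto h.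
have [g gE] := boolp.choice (fun x => qonto (h (loc_in p (gen R x)))).
have [k kE] := @free_lift R X (restr U) g.
have [l lE] := loc_lift k; exists l.
apply: (@loc_hom_ext _ _ (q \o l) h) => x /=; rewrite lE.
move: x; apply: (@lift_ext R X _ (restr_map q \o k) (restr_map h \o @loc_in R p _)) => x /=.
by rewrite kE; exact: gE.
Qed.

End LocalizationFunctor.

(** * Finitely generated modules over a Noetherian ring *)

Section FinitelyGenerated.
Variable R : comPzRingType.

Lemma span_sub (V : lmodType R) (A : set V) (N : submodClosed V) x :
  (forall y, A y -> y \in N) -> x \in span A -> x \in N.
Proof. by move=> AN /asboolP; apply=> y /AN. Qed.

Lemma mem_span (V : lmodType R) (A : set V) x : A x -> x \in span A.
Proof. by move=> Ax; apply/asboolP => N; apply. Qed.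

Lemma mem_imm (U V : lmodType R) (f : {linear U -> V}) y :
  y \in imm f <-> exists x, f x = y.
Proof.
by split=> [/asboolP[x ->]|[x <-]]; [exists x|apply/asboolP; exists x].
Qed.

(** Lift generators of the image f N and add generators of N :&: ker f: after
    subtracting a combination of the lifts, an element of N falls in the kernel. *)
Lemma finitely_generated_image_kernel (U V : lmodType R) (f : {linear U -> V})
    (N : submodClosed U) :
  finitely_generated (imm (f \o @submv _ _ N)) ->
  (exists s : seq U, forall x, x \in span [set` s] <-> x \in N /\ f x = 0) ->
  finitely_generated N.
Proof.
move=> [s sE] [s0 s0E].
have /boolp.choice[g gE] r : exists x, r \in s -> x \in N /\ f x = r.
  have [rs|//] := boolP (r \in s); last by exists 0.
  have : r \in imm (f \o @submv _ _ N) by rewrite sE mem_span.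
  by move=> /mem_imm[x <-]; exists (val x) => _; split=> //; exact: valP.
exists (map g s ++ s0) => x; apply/idP/idP => [Nx|].
  have fx : f x \in imm (f \o @submv _ _ (span [set` map g s])).
    have : f x \in imm (f \o @submv _ _ N) by apply/mem_imm; exists (exist _ x Nx).
    rewrite sE; apply: span_sub => r /= rs; have [_ gr] := gE _ rs.
    have gs : g r \in span [set` map g s] by apply: mem_span; exact: map_f.
    by apply/mem_imm; exists (exist _ (g r) gs).
  move: fx => /mem_imm[[y ys] /= fy]; have {}fy : f y = f x := fy.
  have Ny : y \in N.
    by apply: span_sub ys => _ /= /mapP[r rs ->]; have [] := gE _ rs.
  have xy : x - y \in span [set` s0].
    apply/s0E; split; last by rewrite linearB -fy subrr.
    by rewrite rpredD// submN.
  rewrite -(subrK y x) rpredD//; [move: xy|move: ys]; apply: span_sub => z /= zs;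
  by apply: mem_span; rewrite /= mem_cat zs ?orbT.
apply: span_sub => y /=; rewrite mem_cat => /orP[/mapP[r rs ->]|ys].
  by have [] := gE _ rs.
by have /s0E[] : y \in span [set` s0] by exact: mem_span.
Qed.

Lemma coord_linear (X : choiceType) (i : X) : linear (fun u : free X => val u i : R^o).
Proof. by move=> a u v; rewrite -[val (_ + _)]/(submv (a *: u + v)) linearP. Qed.

(** Induction on the number of coordinates that may be nonzero; the last of them
    maps the submodule onto an ideal of R, and its kernel has one coordinate less. *)
Lemma noetherian_free k (N : submodClosed (@free R 'I_k)) :
  noetherian R -> finitely_generated N.
Proof.
move=> noethR.
suff main m : (m <= k)%N -> forall N : submodClosed (@free R 'I_k),
    (forall x, x \in N -> forall i : 'I_k, (m <= i)%N -> val x i = 0) ->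
    finitely_generated N.
  by apply: (main k) => // x _ i; rewrite leqNgt ltn_ord.
elim: m => [|m IHm] mk {}N Nm.
  exists [::] => x; apply/idP/idP => [Nx|]; last by apply: span_sub.
  rewrite (_ : x = 0) ?rpred0//; apply/val_inj/funext => i; exact: (Nm x).
have [c cE] := linear_pack (@coord_linear _ (Ordinal mk)).
apply: (@finitely_generated_image_kernel _ _ c); first exact: noethR.
pose K := imm (@submv _ _ N \o @submv _ _ (kerm (c \o @submv _ _ N))).
have KE x : x \in K <-> x \in N /\ c x = 0.
  split=> [/mem_imm[y /= <-]|[Nx cx]].
    by split; [exact: submv_mem|apply/(@kermE _ _ _ (c \o @submv _ _ N)); exact: submv_mem].
  have [y yx] := submv_onto Nx.
  have /submv_onto[z zy] : y \in kerm (c \o @submv _ _ N).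
    by apply/kermE; rewrite /= yx.
  by apply/mem_imm; exists z; rewrite /= zy.
have [|s sE] := IHm (ltnW mk) K.
  move=> x /KE[Nx cx] i; rewrite leq_eqVlt => /orP[/eqP mi|/Nm]; last exact.
  by rewrite cE in cx; rewrite (_ : i = Ordinal mk)//; apply: val_inj.
by exists s => x; rewrite -sE; exact: KE.
Qed.

Definition fg (T : lmodType R) := exists k (q : {linear @free R 'I_k -> T}), onto q.

Lemma finitely_generated_cover (V : lmodType R) (N : submodClosed V) :
  finitely_generated N ->
  exists k (q : {linear @free R 'I_k -> V}), forall y, y \in N <-> exists u, q u = y.
Proof.
move=> [s sE]; have [q qE] := @free_lift R 'I_(size s) V (fun i => nth 0 s i).
exists (size s), q => y; split=> [|[u <-]].
  rewrite sE => ys; apply/mem_imm; apply: span_sub ys => z /= zs; apply/mem_imm.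
  have zi : (index z s < size s)%N by rewrite index_mem.
  by exists (gen R (Ordinal zi)); rewrite qE /= nth_index.
rewrite sE -[q u]/(id _).
have [r rE] : exists r : {linear @free R 'I_(size s) -> quotm (span [set` s])},
    forall u, r u = quotm_pi _ (q u) by exists (@quotm_pi _ _ _ \o q).
have /(_ u) : r =1 \0 by apply: lift_ext => i; rewrite rE qE;
  apply/(@quotm_eqP _ _ (span [set` s]) _ 0); rewrite subr0; apply/mem_span/mem_nth.
rewrite rE => /(@quotm_eqP _ _ (span [set` s]) _ 0).
by rewrite subr0.
Qed.

Lemma fg_subm (V : lmodType R) (N : submodClosed V) :
  finitely_generated N -> fg (subm N).
Proof.
move=> /finitely_generated_cover[k [q qE]].
have [|l lE] := factor_mono (j := @submv _ _ N) (h := q) val_inj.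
  move=> u; apply: submv_onto; apply/qE; by exists u.
exists k, l => y; have /qE[u qu] := valP y.
by exists u; apply: val_inj; rewrite -[val (l u)]/(submv (l u)) lE.
Qed.

Lemma fg_top (V : lmodType R) : finitely_generated (topm V) -> fg V.
Proof.
move=> /finitely_generated_cover[k [q qE]].
by exists k, q => y; apply/qE.
Qed.

Lemma fg_onto (U V : lmodType R) (f : {linear U -> V}) : onto f -> fg U -> fg V.
Proof.
move=> fonto [k [q qonto]]; exists k, (f \o q) => y.
by have [x <-] := fonto y; have [u <-] := qonto x; exists u.
Qed.

End FinitelyGenerated.

(** * Ext of a finitely generated module and localization of the coefficients *)

Section HomLocalization.
Variables (R : comPzRingType) (p : spec R) (M : lmodType R).

Lemma common_den (I : eqType) (P : I -> denom p -> Prop) (l : seq I) :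
  (forall i s t, P i s -> P i (dmul t s)) -> (forall i, exists s, P i s) ->
  exists s, forall i, i \in l -> P i s.
Proof.
move=> PM Pex; elim: l => [|i l [s sP]]; first by exists (done1 p).
have [t tP] := Pex i; exists (dmul s t) => k; rewrite inE => /orP[/eqP->|/sP].
  exact: PM.
by rewrite dmulC; exact: PM.
Qed.

Lemma hom_loc_torsion (T : lmodType R) (h : {linear T -> M}) : fg T ->
  (forall x, loc_in p (h x) = 0) -> exists s : denom p, forall x, val s *: h x = 0.
Proof.
move=> [k [q qonto]] h0.
have [||s sP] := @common_den 'I_k (fun i s => val s *: h (q (gen R i)) = 0) (enum 'I_k).
- by move=> i s t /= e; rewrite -scalerA e scaler0.
- by move=> i; have /loc_in_eq0 := h0 (q (gen R i)).
exists s => x; have [u <-] := qonto x.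
have [f fE] : exists f : {linear @free R 'I_k -> M}, forall u, f u = val s *: h (q u).
  by exists (val s \*: (h \o q)).
have -> : val s *: h (q u) = (\0 : {linear @free R 'I_k -> M}) u; last by [].
by rewrite -fE; apply: lift_ext => i; rewrite fE sP ?mem_enum.
Qed.

Lemma hom_loc_free k (g : {linear @free R 'I_k -> restr (locmod p M)}) :
  exists (s : denom p) (h : {linear @free R 'I_k -> M}),
    forall x, loc_in p (h x) = val s *: g x.
Proof.
pose P (i : 'I_k) (s : denom p) := exists m, loc_in p m = val s *: g (gen R i).
have [||s sP] := @common_den 'I_k P (enum 'I_k).
- move=> i s t [m mE]; exists (val t *: m).
  by rewrite linearZ /= mE scalerA.
- by move=> i; have [s [m mE]] := loc_den (g (gen R i)); exists s, m.
have /boolp.choice[m mE] i : exists m, loc_in p m = val s *: g (gen R i).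
  by apply: sP; rewrite mem_enum.
have [h hE] := free_lift m; exists s, h.
have [f fE] : exists f : {linear @free R 'I_k -> restr (locmod p M)},
  forall u, f u = val s *: g u by exists (val s \*: g).
move=> x; rewrite -fE; move: x.
by apply: (@lift_ext R _ _ (@loc_in R p M \o h)) => i; rewrite fE /= hE.
Qed.

(** Clear denominators on a finite free cover q; the map obtained kills the
    relations only up to torsion, and as they are finitely generated one more
    denominator makes it descend to T. *)
Lemma hom_loc_fg (T : lmodType R) (g : {linear T -> restr (locmod p M)}) :
  noetherian R -> fg T ->
  exists (s : denom p) (h : {linear T -> M}), forall x, loc_in p (h x) = val s *: g x.
Proof.
move=> noethR [k [q qonto]].
have [s [h hE]] := hom_loc_free (g \o q).
have [|t tE] := @hom_loc_torsion (subm (kerm q)) (h \o @submv _ _ (kerm q))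
    (fg_subm (noetherian_free _ noethR)).
  by move=> x; rewrite /= hE /= (ses_comp0 _ (ses_kerm qonto)) linear0 scaler0.
have [|l lE] := factor_epi (h := val t \*: h) qonto.
  by move=> x /kermE/submv_onto[y <-]; exact: tE.
exists (dmul t s), l => x; have [u <-] := qonto x.
by rewrite lE /= linearZ /= hE scalerA.
Qed.

End HomLocalization.

Section StablyFG.
Variables (R : comPzRingType) (noethR : noetherian R).

(** The canonical resolution is free on all elements, so that its syzygies are
    rarely finitely generated.  They are so up to maps that lift to a free module,
    which is all that Ext sees. *)
Definition stably_fg (S : lmodType R) := exists (T : lmodType R)
  (f : {linear S -> T}) (g : {linear T -> S}) (w : {linear S -> free S}),
  fg T /\ forall x, aug S (w x) = x - g (f x).

Lemma fg_stably_fg S : fg S -> stably_fg S.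
Proof.
move=> fgS; exists S, idfun, idfun, \0; split=> // x.
by rewrite linear0 subrr.
Qed.

(** The data that Ext of S is computed from: the identity of syz S is the composite
    g f through the finitely generated T plus a map v that extends to free S, and
    f and g are restrictions of maps between the free covers. *)
Lemma stably_fg_split (S : lmodType R) : stably_fg S ->
  exists k (T : lmodType R) (j : {linear T -> @free R 'I_k})
    (A : {linear free S -> @free R 'I_k}) (B : {linear @free R 'I_k -> free S})
    (f : {linear syz S -> T}) (g : {linear T -> syz S}) (v : {linear free S -> syz S}),
  [/\ fg T, forall x, j (f x) = A (submv x), forall y, submv (g y) = B (j y) &
      forall x, v (submv x) = x - g (f x)].
Proof.
move=> [T [f [g [w [[k [q qonto]] wE]]]]].
have sq := ses_kerm qonto.
have [A [f1 [AE f1E]]] := ses_lift f (@projective_free _ _) (ses_aug S) sq.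
have [B [g1 [BE g1E]]] := ses_lift g (@projective_free _ _) sq (ses_aug S).
have [|||v vE] := @stable_ses _ _ _ _ _ _ (g \o f) w (B \o A) (g1 \o f1) (ses_aug S).
- exact: wE.
- by move=> x /=; rewrite BE AE.
- by move=> x /=; rewrite g1E f1E.
exists k, (subm (kerm q)), (@submv _ _ (kerm q)), A, B, f1, g1, v; split=> //.
exact/fg_subm/noetherian_free.
Qed.

Lemma stably_fg_syz (S : lmodType R) : stably_fg S -> stably_fg (syz S).
Proof.
move=> /stably_fg_split[k [T [j [A [B [f [g [v [fgT _ _ vE]]]]]]]]].
have [u uE] := projective_free (@onto_aug _ (syz S)) v.
exists T, f, g, (u \o @submv _ _ _); split=> // x.
by rewrite /= uE vE.
Qed.

Lemma stably_fg_syzn i (N : lmodType R) : fg N -> stably_fg (syzn i N).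
Proof. by move=> fgN; elim: i => [|i IH]; [exact: fg_stably_fg|exact: stably_fg_syz]. Qed.

Section ExtLocIn.
Variables (p : spec R) (N M : lmodType R) (fgN : fg N).

(** Let a : syz S -> T and c : T -> syz S come from [stably_fg_split].  If f with
    localized values extends to free S, then f c extends, after clearing
    denominators, to the finite free module around T; so f c a extends to free S, and
    it differs from f by a map that extends by construction. *)
Lemma ext_loc_in_torsion i (f : {linear syzn i N -> M}) :
  ext_class (@loc_in R p M \o f) = 0 -> exists s : denom p, val s *: ext_class f = 0.
Proof.
case: i f => [|i] f.
  move=> /ext0_class_eq0 f0; have [s sf] := hom_loc_torsion fgN f0; exists s.
  rewrite -(ext_classZ (h := val s \*: f))//.
  by apply/ext0_class_eq0.
move=> /extS_class_eq0[G GE].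
have [k [T [j [A [B [a [c [v [fgT aE cE vE]]]]]]]]] := stably_fg_split (stably_fg_syzn i fgN).
have [s [h hE]] := hom_loc_free (G \o B).
have [h' h'E] : exists h' : {linear T -> M},
    forall y, h' y = val s *: f (c y) - h (j y).
  by exists ((val s \*: (f \o c)) \- (h \o j)).
have [|t tE] := hom_loc_torsion (p := p) (h := h') fgT.
  by move=> y; rewrite h'E linearB linearZ /= hE /= -cE -GE /= subrr.
exists (dmul t s).
rewrite -(ext_classZ (h := val (dmul t s) \*: f))//.
apply/extS_class_eq0; exists ((val t \*: (h \o A)) \+ (val (dmul t s) \*: (f \o v))) => u.
have /eqP := tE (a u); rewrite h'E scalerBr subr_eq0 => /eqP e.
by rewrite /= -aE -e scalerA vE linearB scalerBr addrC subrK.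
Qed.

(** Clear the denominators of the given map on T, which carries its class. *)
Lemma ext_loc_in_onto i (g : {linear syzn i N -> restr (locmod p M)}) :
  exists (s : denom p) (f : {linear syzn i N -> M}),
    ext_class (@loc_in R p M \o f) = val s *: ext_class g.
Proof.
case: i g => [|i] g.
  have [s [h hE]] := hom_loc_fg g noethR fgN; exists s, h.
  exact: ext_classZ.
have [k [T [j [A [B [a [c [v [fgT aE cE vE]]]]]]]]] := stably_fg_split (stably_fg_syzn i fgN).
have [s [h hE]] := hom_loc_fg (g \o c) noethR fgT; exists s, (h \o a).
rewrite -(ext_classZ (h := val s \*: g))//.
apply: (@eq_extS_class _ _ _ _ _ _ (- val s \*: (g \o v))) => u.
by rewrite /= hE /= scaleNr vE linearB scalerBr opprB addrC subrK.
Qed.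

End ExtLocIn.
End StablyFG.

(** * Syzygies over the ring and over its localization *)

Section BaseChange.
Variables (R : comPzRingType) (p : spec R).
Notation Rp := (locring p).

Section BaseSyz.
Variables (S : lmodType R) (S' : lmodType Rp) (nu : {linear S -> restr S'}).

(** Generators go to generators, which makes the induced maps of syzygies strictly
    natural in nu, as the passage to the limit over the powers of an ideal needs. *)
Definition base_free : {linear free S -> restr (free S')} :=
  lift (fun x => gen Rp (nu x) : restr (free S')).

Lemma base_free_gen x : base_free (gen R x) = gen Rp (nu x).
Proof. exact: lift_gen. Qed.

Lemma aug_base_free u : aug S' (base_free u) = nu (aug S u).
Proof.
apply: (@lift_ext R _ _ (restr_map (aug S') \o base_free) (nu \o aug S)) => x /=.
by rewrite base_free_gen /restr_map (lift_gen id) (lift_gen id).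
Qed.

Lemma base_syz_subproof (u : syz S) : (base_free (submv u) : free S') \in kerm (aug S').
Proof. by apply/kermE; rewrite aug_base_free (ses_comp0 _ (ses_aug S)) linear0. Qed.

Definition base_syz_fun (u : syz S) : restr (syz S') :=
  exist (fun y => y \in kerm (aug S')) (base_free (submv u) : free S')
    (base_syz_subproof u).

Lemma base_syz_linear : linear base_syz_fun.
Proof. by move=> a x y; apply: val_inj; exact: (linearP (base_free \o @submv _ _ _)). Qed.
HB.instance Definition _ := GRing.isLinear.Build R (syz S) (restr (syz S')) _
  base_syz_fun base_syz_linear.

Definition base_syz : {linear syz S -> restr (syz S')} := base_syz_fun.

End BaseSyz.

Fixpoint base_syzn (i : nat) (N : lmodType R) (N' : lmodType Rp)
    (nu : {linear N -> restr N'}) : {linear syzn i N -> restr (syzn i N')} :=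
  if i is i'.+1 then base_syz (base_syzn i' nu) else nu.

Lemma base_syz_natural (S T : lmodType R) (S' T' : lmodType Rp)
    (nuS : {linear S -> restr S'}) (nuT : {linear T -> restr T'})
    (h : {linear S -> T}) (h' : {linear S' -> T'}) :
  (forall x, nuT (h x) = h' (nuS x)) ->
  forall x, base_syz nuT (syz_map h x) = syz_map h' (base_syz nuS x).
Proof.
move=> hh' x; apply: val_inj.
have key : forall u, base_free nuT (free_map h u) = free_map h' (base_free nuS u).
  apply: (@lift_ext R _ _ (base_free nuT \o free_map h)
    (restr_map (free_map h') \o base_free nuS)) => y /=.
  rewrite /restr_map base_free_gen.
  rewrite [free_map h _]lift_gen [free_map h' _]lift_gen base_free_gen hh'.
  by [].
exact: (key (submv x)).
Qed.

Lemma base_syzn_natural i (S T : lmodType R) (S' T' : lmodType Rp)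
    (nuS : {linear S -> restr S'}) (nuT : {linear T -> restr T'})
    (h : {linear S -> T}) (h' : {linear S' -> T'}) :
  (forall x, nuT (h x) = h' (nuS x)) ->
  forall x, base_syzn i nuT (syzn_map i h x) = syzn_map i h' (base_syzn i nuS x).
Proof. by move=> hh'; elim: i => [|i IH] //; exact: base_syz_natural. Qed.

Section StablyLocal.
Variables (S : lmodType R) (S' : lmodType Rp).

Definition is_loc (nu : {linear S -> restr S'}) :=
  exists (nup : {linear locmod p S -> S'}) (mu : {linear S' -> locmod p S}),
  [/\ forall x, nup (loc_in p x) = nu x, cancel mu nup & cancel nup mu].

(** Being the localization, up to maps that lift to the free covers.  The syzygy of S
    over R does not in general localize to that of S' over R_p, as the covers are
    free on different sets; this weaker property does survive the passage to
    syzygies. *)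
Definition stably_loc (nu : {linear S -> restr S'}) :=
  exists (nup : {linear locmod p S -> S'}) (mu : {linear S' -> locmod p S})
    (w : {linear S' -> free S'}) (w' : {linear locmod p S -> locmod p (free S)})
    (qp : {linear locmod p (free S) -> locmod p S}),
  [/\ forall x, nup (loc_in p x) = nu x,
      forall x, qp (loc_in p x) = loc_in p (aug S x),
      forall y, aug S' (w y) = y - nup (mu y) &
      forall y, qp (w' y) = y - mu (nup y)].

Lemma is_loc_stably_loc nu : is_loc nu -> stably_loc nu.
Proof.
move=> [nup [mu [nupE muK nupK]]]; have [qp qpE] := loc_map p (aug S).
exists nup, mu, \0, \0, qp; split=> // y.
  by rewrite muK linear0 subrr.
by rewrite nupK linear0 subrr.
Qed.

(** One dimension shift: lift [nup] and [mu] to the covers, restrict to the syzygies,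
    and apply [stable_ses] to both composites. *)
Lemma stably_loc_split nu : stably_loc nu -> exists
    (A : {linear free S' -> locmod p (free S)})
    (jp : {linear locmod p (syz S) -> locmod p (free S)})
    (nup : {linear locmod p (syz S) -> syz S'}) (mu : {linear syz S' -> locmod p (syz S)})
    (v : {linear free S' -> syz S'}) (v' : {linear locmod p (free S) -> locmod p (syz S)}),
  [/\ forall x, jp (loc_in p x) = loc_in p (submv x),
      forall x, nup (loc_in p x) = base_syz nu x,
      forall y, jp (mu y) = A (submv y),
      forall y, v (submv y) = y - nup (mu y) &
      forall z, v' (jp z) = z - mu (nup z)].
Proof.
move=> [nup [mu [w [w' [qp [nupE qpE wE w'E]]]]]].
have [jp jpE] := loc_map p (@submv _ _ (kerm (aug S))).
have sp := loc_ses jpE qpE (ses_aug S).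
have [A [mu1 [AE mu1E]]] := ses_lift mu (@projective_free _ _) (ses_aug S') sp.
have [B BE] := loc_lift (base_free nu).
have [nu1 nu1E] := loc_lift (base_syz nu).
have augB x : aug S' (B x) = nup (qp x).
  apply: (loc_hom_ext (k := aug S' \o B) (k' := nup \o qp)) => {}x /=.
  by rewrite BE qpE nupE aug_base_free.
have jB x : submv (nu1 x) = B (jp x).
  apply: (loc_hom_ext (k := @submv _ _ (kerm (aug S')) \o nu1) (k' := B \o jp)) => {}x /=.
  exact: etrans (congr1 (@submv _ _ _) (nu1E x)) (esym (etrans (congr1 B (jpE x)) (BE _))).
have [|||v vE] := @stable_ses _ _ _ _ _ _ (nup \o mu) w (B \o A) (nu1 \o mu1) (ses_aug S').
- exact: wE.
- by move=> x /=; rewrite augB AE.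
- by move=> x; exact: etrans (jB (mu1 x)) (congr1 B (mu1E x)).
have [|||v' v'E] := @stable_ses _ _ _ _ _ _ (mu \o nup) w' (A \o B) (mu1 \o nu1) sp.
- exact: w'E.
- by move=> x /=; rewrite AE augB.
- by move=> x; exact: etrans (mu1E (nu1 x)) (congr1 A (jB x)).
by exists A, jp, nu1, mu1, v, v'.
Qed.

End StablyLocal.

Lemma stably_loc_syz (S : lmodType R) (S' : lmodType Rp) (nu : {linear S -> restr S'}) :
  stably_loc nu -> stably_loc (base_syz nu).
Proof.
move=> /stably_loc_split[A [jp [nup [mu [v [v' [jpE nupE jmu vE v'E]]]]]]].
have [w wE] := projective_free (@onto_aug _ (syz S')) v.
have [jq jqE] := loc_map p (@submv _ _ (kerm (aug (syz S)))).
have [qp qpE] := loc_map p (aug (syz S)).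
have sq := loc_ses jqE qpE (ses_aug (syz S)).
have [w' w'E] := @loc_projective_free R p S _ _ qp (ses_onto sq) v'.
exists nup, mu, (w \o @submv _ _ _), (w' \o jp), qp; split=> // y.
  exact: etrans (wE (submv y)) (vE y).
exact: etrans (w'E (jp y)) (v'E y).
Qed.

Lemma stably_loc_syzn i (N : lmodType R) (N' : lmodType Rp) (nu : {linear N -> restr N'}) :
  is_loc nu -> stably_loc (base_syzn i nu).
Proof.
by move=> lnu; elim: i => [|i IH]; [exact: is_loc_stably_loc|exact: stably_loc_syz].
Qed.

Section ExtBaseChange.
Variables (N : lmodType R) (N' : lmodType Rp) (nu : {linear N -> restr N'}).
Variables (lnu : is_loc nu) (V : lmodType Rp).

Definition base_ext_class i (f : {linear syzn i N' -> V}) : ext i N (restr V) :=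
  ext_class (restr_map f \o base_syzn i nu).

(** Together with [base_ext_class_onto]: Ext of N' over R_p and Ext of N over R have
    the same value on an R_p-module.  A map on the syzygy over R extends to the
    localized syzygy, which is stably the syzygy over R_p. *)
Lemma base_ext_class_inj i (f : {linear syzn i N' -> V}) :
  base_ext_class f = 0 -> ext_class f = 0.
Proof.
case: i f => [|i] f.
  move=> /ext0_class_eq0 f0; apply/ext0_class_eq0 => y.
  have [nup [mu [nupE muK _]]] := lnu; rewrite -(muK y); move: (mu y) => z.
  by apply: (loc_hom_ext (k := f \o nup) (k' := \0)) => x /=; rewrite nupE; exact: f0.
move=> /extS_class_eq0[G GE].
have [A [jp [nup [mu [v [v' [jpE nupE jmu vE v'E]]]]]]] :=
  stably_loc_split (stably_loc_syzn i lnu).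
have [Gp GpE] := loc_lift G.
have fnu z : f (nup z) = Gp (jp z).
  apply: (loc_hom_ext (k := f \o nup) (k' := Gp \o jp)) => x /=.
  by rewrite nupE jpE GpE; exact: GE.
apply/extS_class_eq0; exists ((Gp \o A) \+ (f \o v)) => y.
by rewrite /= -jmu -fnu vE linearB addrC subrK.
Qed.

Lemma base_ext_class_onto i (g : {linear syzn i N -> restr V}) :
  exists f : {linear syzn i N' -> V}, base_ext_class f = ext_class g.
Proof.
have [gp gpE] := loc_lift g.
case: i g gp gpE => [|i] g gp gpE.
  have [nup [mu [nupE _ nupK]]] := lnu; exists (gp \o mu).
  by apply: eq_ext_class => x /=; rewrite /restr_map /= -nupE nupK gpE.
have [A [jp [nup [mu [v [v' [jpE nupE jmu vE v'E]]]]]]] :=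
  stably_loc_split (stably_loc_syzn i lnu).
exists (gp \o mu).
apply: (eq_extS_class (G := restr_map (\0 \- (gp \o v')) \o @loc_in R p _)) => x.
by rewrite /= /restr_map /= sub0r -nupE -jpE v'E linearB gpE opprB addrC subrK.
Qed.

End ExtBaseChange.
End BaseChange.

(** * Localization correspondences *)

Section Correspondence.
Variables (R : comPzRingType) (p : spec R).
Notation Rp := (locring p).

(** A relation that behaves like the graph of the localization map X -> X'.  A
    relation is used because Ext over R and Ext over R_p are linked by a zigzag
    Ext(N, M) -> Ext(N, M_p) <- Ext(N', M_p), whose right arrow is invertible but has
    no explicit inverse. *)
Record loc_corr (X : lmodType R) (X' : lmodType Rp) (rho : X -> X' -> Prop) : Prop :=
  LocCorr {
    corr_linear : forall a x x' y y', rho x x' -> rho y y' ->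
      rho (a *: x + y) (of_base p a *: x' + y');
    corr_left : forall x, exists x', rho x x';
    corr_right : forall x', exists s x, rho x (den s *: x');
    corr_torsion : forall x, rho x 0 -> exists s : denom p, val s *: x = 0;
    corr_inj : forall x', rho 0 x' -> x' = 0 }.

Lemma corrZ (X : lmodType R) (X' : lmodType Rp) (rho : X -> X' -> Prop) a x x' :
  loc_corr rho -> rho x x' -> rho (a *: x) (of_base p a *: x').
Proof.
move=> corr xx'; have [y y0] := corr_left corr 0.
have /= := corr_linear corr a xx' y0.
by rewrite addr0 (corr_inj corr y0) addr0.
Qed.

Section ExtCorrespondence.
Variables (i : nat) (M : lmodType R).

(** Classes whose images in the middle term of the zigzag agree. *)
Definition ext_corr (N : lmodType R) (N' : lmodType Rp) (nu : {linear N -> restr N'})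
    (x : ext i N M) (x' : ext i N' (locmod p M)) :=
  exists (f : {linear syzn i N -> M}) (f' : {linear syzn i N' -> locmod p M}),
  [/\ x = ext_class f, x' = ext_class f' &
      ext_class (@loc_in R p M \o f) = base_ext_class nu f'].

Lemma loc_in_ext_class0 (N : lmodType R) (f : {linear syzn i N -> M}) :
  ext_class f = 0 -> ext_class (@loc_in R p M \o f) = 0.
Proof.
case: i f => [|k] f.
  move=> /ext0_class_eq0 f0; apply/ext0_class_eq0 => x /=.
  by rewrite f0; exact: (linear0 (@loc_in R p M)).
move=> /extS_class_eq0[G GE]; apply/extS_class_eq0.
by exists (@loc_in R p M \o G) => u /=; rewrite GE.
Qed.

Lemma base_ext_class0 (N : lmodType R) (N' : lmodType Rp) (nu : {linear N -> restr N'})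
    (V : lmodType Rp) (f : {linear syzn i N' -> V}) :
  ext_class f = 0 -> base_ext_class nu f = 0.
Proof.
case: i f => [|k] f.
  by move=> /ext0_class_eq0 f0; apply/ext0_class_eq0 => x; exact: f0.
move=> /extS_class_eq0[G GE]; apply/extS_class_eq0.
by exists (restr_map G \o base_free (base_syzn k nu)) => u; exact: GE.
Qed.

Lemma ext_corrP (N : lmodType R) (N' : lmodType Rp) (nu : {linear N -> restr N'}) :
  noetherian R -> fg N -> is_loc nu -> loc_corr (ext_corr nu).
Proof.
move=> noethR fgN lnu; split.
- move=> a x x' y y' [f [f' [-> -> ff']]] [g [g' [-> -> gg']]].
  exists ((a \*: f) \+ g), ((of_base p a \*: f') \+ g'); split.
  + by apply/esym/ext_class_linear.
  + by apply/esym/ext_class_linear.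
  transitivity (a *: ext_class (@loc_in R p M \o f) + ext_class (@loc_in R p M \o g)).
    by apply: ext_class_linear => u /=; exact: (linearP (@loc_in R p M)).
  by rewrite ff' gg'; apply/esym/ext_class_linear.
- move=> x; have [f ->] := ext_class_onto x.
  have [f' f'E] := base_ext_class_onto lnu (@loc_in R p M \o f).
  by exists (ext_class f'), f, f'.
- move=> x'; have [f' ->] := ext_class_onto x'.
  have [s [f fE]] := ext_loc_in_onto noethR fgN (restr_map f' \o base_syzn i nu).
  exists s, (ext_class f), f, (den s \*: f'); split=> //.
    by apply/esym/ext_classZ.
  by rewrite fE; apply/esym/ext_classZ.
- move=> x [f [f' [-> f'0 ff']]]; apply: (ext_loc_in_torsion noethR fgN).
  by rewrite ff' base_ext_class0.
move=> x' [f [f' [f0 -> ff']]]; apply: (base_ext_class_inj lnu).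
by rewrite -ff' loc_in_ext_class0.
Qed.

Lemma ext_corr_natural (S T : lmodType R) (S' T' : lmodType Rp)
    (nuS : {linear S -> restr S'}) (nuT : {linear T -> restr T'})
    (h : {linear S -> T}) (h' : {linear S' -> T'}) x x' :
  (forall x, nuT (h x) = h' (nuS x)) -> ext_corr nuT x x' ->
  ext_corr nuS (ext_map i M h x) (ext_map i (locmod p M) h' x').
Proof.
move=> hh' [f [f' [-> -> ff']]].
exists (f \o syzn_map i h), (f' \o syzn_map i h'); split; rewrite ?ext_map_class//.
transitivity (ext_map i (restr (locmod p M)) h (ext_class (@loc_in R p M \o f))).
  by rewrite ext_map_class; exact: eq_ext_class.
rewrite ff' ext_map_class; apply: eq_ext_class => u /=.
by rewrite /restr_map /= (base_syzn_natural hh').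
Qed.

End ExtCorrespondence.

Section DirectLimit.

Section Classes.
Variables (A : comPzRingType) (E : nat -> lmodType A).
Variable phi : forall n, {linear E n -> E n.+1}.

Definition dlim_class (z : subm (compatible phi)) : dlim phi :=
  quotm_pi (comap (@submv _ _ (compatible phi)) (eventually0 (E := E))) z.

Lemma dlim_class_onto x : exists z, x = dlim_class z.
Proof. by elim/quotmW: x => z; exists z. Qed.

Lemma dlim_class_linear a y z : dlim_class (a *: y + z) = a *: dlim_class y + dlim_class z.
Proof. exact: linearP. Qed.

Lemma dlim_class_eq0 z :
  dlim_class z = 0 <-> exists k, forall n, (k <= n)%N -> submv z n = 0.
Proof.
rewrite -[0](linear0 (quotm_pi _)); split=> [/quotm_eqP|z0].
  by rewrite subr0 => /asboolP.
by apply/quotm_eqP; rewrite subr0; apply/asboolP.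
Qed.

Lemma dlim_compatible (z : subm (compatible phi)) :
  exists k, forall n, (k <= n)%N -> submv z n.+1 = phi n (submv z n).
Proof. exact/asboolP/(valP z). Qed.

End Classes.

(** The tail of z is forced; induction on k, shifting the system, avoids transporting
    x along equalities of indices. *)
Lemma dlim_germ k (A : comPzRingType) (E : nat -> lmodType A)
    (phi : forall n, {linear E n -> E n.+1}) (x : E k) :
  exists z : subm (compatible phi),
    submv z k = x /\ forall n, (k <= n)%N -> submv z n.+1 = phi n (submv z n).
Proof.
suff [z [zk zS]] : exists z : seqprod E,
    z k = x /\ forall n, (k <= n)%N -> z n.+1 = phi n (z n).
  have cz : z \in compatible phi by apply/asboolP; exists k.
  by have [y yz] := submv_onto cz; exists y; rewrite yz.
elim: k E phi x => [|k IHk] E phi x.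
  pose z := fix z n : E n := if n is m.+1 then phi m (z m) else x.
  by exists z.
have [z [zk zS]] := IHk (fun n => E n.+1) (fun n => phi n.+1) x.
pose y n : E n := if n is m.+1 then z m else 0.
by exists y; split=> // -[|n]//; exact: zS.
Qed.

Variables (E : nat -> lmodType R) (phi : forall n, {linear E n -> E n.+1}).
Variables (E' : nat -> lmodType Rp) (phi' : forall n, {linear E' n -> E' n.+1}).
Variable rho : forall n, E n -> E' n -> Prop.
Hypothesis rhoP : forall n, loc_corr (@rho n).
Hypothesis rho_phi : forall n x x', rho x x' -> rho (phi n x) (phi' n x').

Definition dlim_corr (x : dlim phi) (x' : dlim phi') :=
  exists z z', [/\ x = dlim_class z, x' = dlim_class z' &
    exists k, forall n, (k <= n)%N -> rho (submv z n) (submv z' n)].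

Lemma rho_germ k (z : seqprod E) (z' : seqprod E') : rho (z k) (z' k) ->
  (forall n, (k <= n)%N -> z n.+1 = phi n (z n)) ->
  (forall n, (k <= n)%N -> z' n.+1 = phi' n (z' n)) ->
  forall n, (k <= n)%N -> rho (z n) (z' n).
Proof.
move=> zz' zS z'S n /subnK<-; elim: (n - k)%N => [|m IH] //=.
by rewrite addSn zS ?leq_addl// z'S ?leq_addl//; exact: rho_phi.
Qed.

(** Correspondences compatible with the transition maps pass to the limit: two
    compatible families that correspond at one index correspond from there on, and a
    denominator found at one index serves for all later ones. *)
Lemma dlim_corrP : loc_corr dlim_corr.
Proof.
split.
- move=> a x x' y y' [z [z' [-> -> [k kP]]]] [w [w' [-> -> [l lP]]]].
  exists (a *: z + w), (of_base p a *: z' + w'); split; rewrite ?dlim_class_linear//.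
  exists (maxn k l) => n; rewrite geq_max => /andP[kn ln].
  exact: (corr_linear (rhoP n) a (kP n kn) (lP n ln)).
- move=> x; have [z ->] := dlim_class_onto x; have [k zS] := dlim_compatible z.
  have [y zy] := corr_left (rhoP k) (submv z k).
  have [z' [z'k z'S]] := dlim_germ phi' y.
  exists (dlim_class z'), z, z'; split=> //; exists k.
  by apply: rho_germ => //; rewrite z'k.
- move=> x'; have [z' ->] := dlim_class_onto x'; have [k z'S] := dlim_compatible z'.
  have [s [y yz']] := corr_right (rhoP k) (submv z' k).
  have [z [zk zS]] := dlim_germ phi y.
  have sz'E n : submv (den s *: z') n = den s *: submv z' n by [].
  exists s, (dlim_class z), z, (den s *: z'); split=> //.
    by have := dlim_class_linear (den s) z' 0; rewrite addr0 => ->;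
      rewrite [X in _ + X](linear0 (quotm_pi _)) addr0.
  exists k; apply: rho_germ => //; first by rewrite zk sz'E.
  by move=> n kn; rewrite !sz'E z'S// linearZ.
- move=> x [z [z' [-> /esym/dlim_class_eq0[l z'0] [k zz']]]].
  have [m zS] := dlim_compatible z.
  pose n := maxn k (maxn l m).
  have [kn ln mn] : [/\ k <= n, l <= n & m <= n]%N by rewrite /n !leq_max !leqnn !orbT.
  have := zz' n kn; rewrite z'0// => /(corr_torsion (rhoP n))[s sz]; exists s.
  have <- : dlim_class (val s *: z + 0) = val s *: dlim_class z.
    by rewrite dlim_class_linear [X in _ + X](linear0 (quotm_pi _)) addr0.
  apply/dlim_class_eq0; exists n => h /subnK<-; rewrite addr0.
  have szE q : submv (val s *: z) q = val s *: submv z q by [].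
  rewrite szE; elim: (h - n)%N => [|q IH]; first exact: sz.
  have mqn : (m <= q + n)%N by rewrite (leq_trans mn)// leq_addl.
  by rewrite addSn zS// -linearZ_LR IH linear0.
move=> x' [z [z' [/esym/dlim_class_eq0[l z0] -> [k zz']]]].
apply/dlim_class_eq0; exists (maxn k l) => n; rewrite geq_max => /andP[kn ln].
by apply: (corr_inj (rhoP n)); rewrite -(z0 n ln); exact: zz'.
Qed.

End DirectLimit.
End Correspondence.

(** * Ideal powers and local cohomology at a prime *)

Section IdealPowers.
Variables (R : comPzRingType) (p : spec R).
Notation Rp := (locring p).

Lemma base_scalar_linear : linear (of_base p : R^o -> restr (Rp^o)).
Proof. by move=> a x y; rewrite of_baseD of_baseM. Qed.
HB.instance Definition _ := GRing.isLinear.Build R R^o (restr (Rp^o)) _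
  (of_base p : R^o -> restr (Rp^o)) base_scalar_linear.
Definition base_scalar : {linear R^o -> restr (Rp^o)} := (of_base p : R^o -> restr (Rp^o)).

Lemma of_base_locideal (I : submodClosed R^o) r :
  r \in I -> (of_base p r : Rp^o) \in locideal p I.
Proof. by move=> Ir; apply: mem_span; exists r. Qed.

(** The fractions with numerator in I form the image of the localization of I, so
    they are already a submodule. *)
Lemma mem_locideal (I : submodClosed R^o) (x : Rp^o) :
  x \in locideal p I <-> exists s r, r \in I /\ den s * x = of_base p r.
Proof.
split=> [|[s [r [Ir sx]]]]; last first.
  have -> : x = den_inv s *: (of_base p r : Rp^o).
    by rewrite -sx /GRing.scale /= mulrA denK mul1r.
  by rewrite rpredZ// of_base_locideal.
have [k kE] := loc_lift (base_scalar \o @submv _ _ I).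
move=> xI; have /mem_imm[y <-] : x \in imm k.
  apply: span_sub xI => _ [r Ir <-]; have [u uE] := submv_onto Ir.
  by apply/mem_imm; exists (loc_in p u); rewrite kE /= uE.
have [s [r sy]] := loc_den y; exists s, (submv r); split; first exact: submv_mem.
by have := kE r; rewrite -sy linearZ.
Qed.

Lemma mem_mulm (A : comPzRingType) (I : submodClosed A^o) (V : lmodType A)
    (N : submodClosed V) r x : r \in I -> x \in N -> (r : A) *: x \in mulm I N.
Proof. by move=> Ir Nx; apply: mem_span; exists r, x. Qed.

Lemma mulm_sub (A : comPzRingType) (I : submodClosed A^o) (V : lmodType A)
    (N P : submodClosed V) x :
  (forall r y, r \in I -> y \in N -> (r : A) *: y \in P) -> x \in mulm I N -> x \in P.
Proof. by move=> INP; apply: span_sub => _ [r [y [Ir Ny ->]]]; exact: INP. Qed.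

Lemma expi_locideal (I : submodClosed R^o) n (x : Rp^o) :
  x \in expi (locideal p I) n <-> x \in locideal p (expi I n).
Proof.
elim: n x => [|n IHn] x.
  split=> // _; have [s [r sx]] := locring_den (x : Rp).
  by apply/mem_locideal; exists s, r.
split.
  apply: mulm_sub => c y /mem_locideal[s [r [Ir sc]]] /IHn/mem_locideal[t [u [Iu ty]]].
  apply/mem_locideal; exists (dmul s t), (r * u); split; first exact: mem_mulm.
  by rewrite of_baseM -sc -ty denM -!mulrA; congr (_ * _); rewrite mulrCA.
move=> /mem_locideal[s [r [Ir sx]]].
have -> : x = den_inv s *: (of_base p r : Rp^o).
  by rewrite -sx /GRing.scale /= mulrA denK mul1r.
apply: rpredZ; rewrite -[of_base p r]subr0; apply/quotm_eqP; rewrite linear0.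
apply/(@kermE _ _ _ (restr_map (@quotm_pi _ _ (expi (locideal p I) n.+1)) \o base_scalar)).
apply: mulm_sub Ir => u v Iu Iv; apply/kermE.
rewrite -(linear0 (@quotm_pi _ _ (expi (locideal p I) n.+1))); apply/quotm_eqP.
rewrite subr0 /= [base_scalar _]of_baseM.
by apply: mem_mulm; [exact: of_base_locideal|apply/IHn; exact: of_base_locideal].
Qed.

Section Quotients.
Variables (I : submodClosed R^o) (J : submodClosed Rp^o).
Hypothesis IJ : forall x, x \in J <-> x \in locideal p I.

Definition quot_base_fun (x : quotm I) : restr (quotm J) := quotm_pi J (of_base p (repr x)).

Lemma quot_baseE (r : R^o) : quot_base_fun (quotm_pi I r) = quotm_pi J (of_base p r).
Proof.
apply/quotm_eqP; rewrite -[_ - _](linearB base_scalar); apply/IJ.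
by apply: of_base_locideal; exact: repr_quotm.
Qed.

Lemma quot_base_linear : linear quot_base_fun.
Proof.
move=> a; do 2!elim/quotmW=> ?; rewrite -linearP !quot_baseE.
by rewrite [of_base _ _](linearP base_scalar) [LHS](linearP (quotm_pi J)).
Qed.
HB.instance Definition _ := GRing.isLinear.Build R (quotm I) (restr (quotm J)) _
  quot_base_fun quot_base_linear.
Definition quot_base : {linear quotm I -> restr (quotm J)} := quot_base_fun.

(** The inverse map sends the class of c to c times the fraction 1/1. *)
Lemma quot_base_is_loc : is_loc quot_base.
Proof.
have [nup nupE] := loc_lift quot_base.
pose one : locmod p (quotm I) := loc_in p (quotm_pi I (1 : R^o)).
have [g gE] : exists g : {linear Rp^o -> locmod p (quotm I)}, forall c, g c = (c : Rp) *: one.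
  have /linear_pack[g gE] : linear (fun c : Rp^o => (c : Rp) *: one).
    by move=> a x y; rewrite scalerDl scalerA.
  by exists g => c; rewrite gE.
have oneE r : of_base p r *: one = loc_in p (quotm_pi I (r : R^o)).
  rewrite -loc_inZ -linearZ; congr (loc_in p (quotm_pi I _)).
  by rewrite /GRing.scale /= mulr1.
have [||mu muE] := @factor_epi _ _ _ _ (quotm_pi J) g.
- by elim/quotmW=> x; exists x.
- move=> x; rewrite -[0](linear0 (quotm_pi J)) => /quotm_eqP.
  rewrite subr0 => /IJ/mem_locideal[s [r [Ir sx]]]; rewrite gE.
  apply: (@den_scale_inj _ _ _ s); rewrite scalerA sx oneE scaler0.
  have -> : quotm_pi I r = 0 by rewrite -[0](linear0 (quotm_pi I)); apply/quotm_eqP; rewrite subr0.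
  exact: (linear0 (@loc_in R p _)).
exists nup, mu; split=> //.
- elim/quotmW=> c; rewrite muE gE linearZ /= nupE.
  rewrite [quot_base _]quot_baseE -linearZ; congr quotm_pi.
  by rewrite /GRing.scale /= of_base1 mulr1.
apply: (@loc_hom_ext _ _ _ _ (mu \o nup) idfun); elim/quotmW=> r /=.
by rewrite nupE [quot_base _]quot_baseE muE gE oneE.
Qed.

End Quotients.
End IdealPowers.

Section LocalCohomology.
Variables (R : comPzRingType) (p : spec R) (a : submodClosed R^o) (M : lmodType R).
Hypothesis noethR : noetherian R.

Definition quot_expi_base n : {linear quot_expi a n -> restr (quot_expi (locideal p a) n)} :=
  quot_base (@expi_locideal R p a n).

Definition local_cohomology_corr i :
    local_cohomology a M i -> local_cohomology (locideal p a) (locmod p M) i -> Prop :=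
  @dlim_corr R p _ _ _ _ (fun n => @ext_corr R p i M _ _ (quot_expi_base n.+1)).

Lemma fg_ring : @fg R R^o.
Proof.
apply: fg_top; exists [:: 1] => x; apply/esym.
rewrite -[x](_ : (x : R) *: (1 : R^o) = x); last by rewrite /GRing.scale /= mulr1.
by apply/rpredZ/mem_span; rewrite /= inE.
Qed.

(** The quotients by powers of the ideal localize to each other compatibly with the
    projections, so the correspondences of Ext modules pass to the limit. *)
Lemma local_cohomology_corrP i : loc_corr (@local_cohomology_corr i).
Proof.
apply: dlim_corrP => [n|n x x'].
  apply: ext_corrP => //; last exact: quot_base_is_loc.
  apply: (@fg_onto _ _ _ (@quotm_pi _ _ (expi a n.+1))) fg_ring.
  by elim/quotmW=> x; exists x.
apply: ext_corr_natural; elim/quotmW=> r.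
rewrite [X in quot_expi_base _ X](quotm_mapE (@expi_homo R a n.+1)).
rewrite [LHS](quot_baseE (@expi_locideal R p a n.+1)).
apply: etrans (esym (quotm_mapE (@expi_homo _ (locideal p a) n.+1) _)) _.
have hh := congr1 (quot_expi_proj (locideal p a) n.+1)
  (esym (quot_baseE (@expi_locideal R p a n.+2) r)).
by apply: etrans hh _.
Qed.

End LocalCohomology.

(** * Support and associated primes *)

Section Support.
Variables (R : comPzRingType) (p : spec R).

(** Elements of I X are killed by denominators as soon as the products r x with r
    in I are; such a product corresponds to r x', and all of X' is reached up to
    denominators. *)
Lemma corr_annihilator (X : lmodType R) (X' : lmodType (locring p)) rho
    (I : submodClosed R^o) (J : submodClosed (locring p)^o) :
  @loc_corr R p X X' rho -> (forall c, c \in J <-> c \in locideal p I) ->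
  (forall x, x \in mulm I (topm X) -> loc_in p x = 0) <->
  (forall x', x' \in mulm J (topm X') -> x' = 0).
Proof.
move=> corr JI; split=> [IX x'|JX x].
  move=> x'J; apply/eqP; rewrite -[_ == 0]/(x' \in botm X'); move: x'J.
  apply: mulm_sub => c {}x' /JI/mem_locideal[s [r [Ir sc]]] _; apply/eqP.
  have [t [x xx']] := corr_right corr x'.
  have /(@loc_in_eq0 R p)[u urx] : loc_in p (r *: x) = 0 by apply: IX; exact: mem_mulm.
  have := corrZ (val u) corr (corrZ (r : R) corr xx'); rewrite urx => /(corr_inj corr).
  rewrite -[X in _ = X -> _](scaler0 _ (den u)) => /(@den_scale_inj _ _ _ u) rtx.
  apply: (@den_scale_inj _ _ _ s); rewrite scaler0 scalerA sc.
  by apply: (@den_scale_inj _ _ _ t); rewrite scaler0 scalerA mulrC -scalerA.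
move=> Ix; apply/(@kermE _ _ _ (@loc_in R p X)); move: Ix.
apply: mulm_sub => r {}x Ir _; apply/kermE; apply/(@loc_in_eq0 R p).
apply: (corr_torsion corr); have [x' xx'] := corr_left corr x.
rewrite -(JX (of_base p r *: x')); first exact: corrZ.
by apply: mem_mulm => //; apply/JI; exact: of_base_locideal.
Qed.

Lemma SuppP (X : lmodType R) : Supp X p <-> exists x : X, loc_in p x <> 0.
Proof.
split=> [[y /eqP y0]|[x /eqP x0]]; last by exists (loc_in p x).
have [s [x sy]] := loc_den y; exists x => x0; apply: y0.
by apply: (@den_scale_inj _ _ _ s); rewrite sy x0 scaler0.
Qed.

Lemma Supp_subm (X : lmodType R) (N : submodClosed X) :
  Supp (subm N) p <-> exists2 x, x \in N & loc_in p x <> 0.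
Proof.
split=> [/SuppP[x x0]|[x /submv_onto[y <-] y0]].
  exists (submv x); first exact: submv_mem.
  move=> /(@loc_in_eq0 R p)[s sx]; apply: x0; apply/(@loc_in_eq0 R p); exists s.
  exact: val_inj.
apply/SuppP; exists y => /(@loc_in_eq0 R p)[s sy]; apply: y0.
by apply/(@loc_in_eq0 R p); exists s; rewrite -linearZ sy linear0.
Qed.

End Support.

(** The whole localization theory enters the proof of the theorem through this
    statement. *)
Lemma Supp_ideal_power_lc (R : comPzRingType) (noethR : noetherian R)
    (a b : submodClosed R^o) (M : lmodType R) t i (p : spec R) :
  Supp (subm (ideal_power_lc a b M t i)) p <->
  exists2 x, x \in ideal_power_lc (locideal p a) (locideal p b) (locmod p M) t i & x != 0.
Proof.
have [H1 H2] :=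
  corr_annihilator (local_cohomology_corrP p a M noethR i) (@expi_locideal R p b t).
split=> [/Supp_subm[x xN x0]|[x xN /eqP x0]].
  apply: contrapT => n; apply: x0; apply: H2 xN => y yN.
  by apply: contrapT => /eqP y0; apply: n; exists y.
apply/Supp_subm; apply: contrapT => n; apply: x0; apply: H1 xN => y yN.
by apply: contrapT => y0; apply: n; exists y.
Qed.

Section AssociatedPrimes.
Variables (R : comPzRingType) (noethR : noetherian R).

Lemma submod_pack (V : lmodType R) (P : V -> bool) : submod_closed P ->
  exists N : submodClosed V, forall x, (x \in N) = P x.
Proof.
move=> cP.
pose m := GRing.isSubmodClosed.Build R V P cP.
pose N : submodClosed V := HB.pack (P : {pred V}) m.
by exists N.
Qed.

(** Otherwise there is a strictly increasing sequence; its union is generated by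
    finitely many elements, which all lie in one term. *)
Lemma noetherian_maximal (T : Type) (I : T -> submodClosed R^o) (P : T -> Prop) t0 :
  P t0 -> exists t, P t /\
    forall t', P t' -> {subset I t <= I t'} -> {subset I t' <= I t}.
Proof.
move=> Pt0; apply: contrapT => nomax.
have /boolp.choice[f fP] (t : T) : exists t', P t ->
    [/\ P t', {subset I t <= I t'} & ~ {subset I t' <= I t}].
  have [Pt|nPt] := pselect (P t); last by exists t.
  apply: contrapT => n; apply: nomax; exists t; split=> // t' Pt' tt'.
  by apply: contrapT => t't; apply: n; exists t'.
pose c n := iter n f t0.
have cP n : P (c n) by elim: n => //= n /fP[].
have cS n : {subset I (c n) <= I (c n.+1)} by have [] := fP _ (cP n).
have cM m n : (m <= n)%N -> {subset I (c m) <= I (c n)}.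
  by move=> /subnK<- r; elim: (n - m)%N => [|k IH] //= /IH; exact: cS.
have [|U UE] := @submod_pack R^o (fun r => `[< exists n, r \in I (c n) >]).
  split=> [|r x y]; rewrite ?unfold_in /=.
    by apply/asboolP; exists 0%N; rewrite rpred0.
  move=> /asboolP[m xm] /asboolP[n yn]; apply/asboolP; exists (maxn m n).
  by rewrite rpredD ?rpredZ//; [apply: cM xm|apply: cM yn]; rewrite leq_max leqnn ?orbT.
have [s sE] := noethR U.
have sU r : r \in s -> r \in U by move=> rs; rewrite sE; exact: mem_span.
have [n nP] : exists n, forall r, r \in s -> r \in I (c n).
  elim: s sU {sE} => [|r s IHs] sU; first by exists 0%N.
  have [x xs|n nP] := IHs; first by apply: sU; rewrite inE xs orbT.
  have /asboolP[m rm] : `[< exists n, r \in I (c n) >] by rewrite -UE sU ?inE ?eqxx.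
  exists (maxn m n) => x; rewrite inE => /orP[/eqP->|/nP xn].
    by apply: cM rm; rewrite leq_max leqnn.
  by apply: cM xn; rewrite leq_max leqnn orbT.
have [_ _] := fP _ (cP n); apply => r rn.
have : r \in U by rewrite UE; apply/asboolP; exists n.+1.
by rewrite sE; apply: span_sub.
Qed.

(** Take x whose annihilator I x in X_p (contracted to R) is maximal among those of
    elements that survive in X_p.  Maximality makes I x prime: if rs kills x and s
    does not, then I (s x) contains I x and is proper, so that r, which kills s x,
    is in I x.  As I x is finitely generated, a single denominator d turns it into
    the annihilator of d x itself. *)
Lemma Supp_Ass (X : lmodType R) (p : spec R) : Supp X p ->
  exists q : spec R, Ass X q /\ {subset (q : {pred R}) <= (p : {pred R})}.
Proof.
move=> /SuppP[x0 x0P].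
have /boolp.choice[I IE] (x : X) : exists I : submodClosed R^o,
    forall r : R^o, r \in I <-> loc_in p ((r : R) *: x) = 0.
  have /linear_pack[h hE] : linear (fun r : R^o => loc_in p ((r : R) *: x)).
    by move=> a r s; rewrite scalerDl -scalerA linearP.
  by exists (kerm h) => r; rewrite kermE hE.
have [x [xP xmax]] := @noetherian_maximal X I (fun x => loc_in p x <> 0) x0 x0P.
have primeI (r s : R) : (r * s : R^o) \in I x -> ((r : R^o) \in I x) || ((s : R^o) \in I x).
  move=> rs; have [//|/negP sx] := boolP ((s : R^o) \in I x); first by rewrite orbT.
  rewrite orbF; apply: (xmax (s *: x)) => [e|u|].
  - by apply: sx; apply/IE.
  - move=> /IE/(@loc_in_eq0 R p)[t tux]; apply/IE/(@loc_in_eq0 R p); exists t.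
    move: tux; rewrite !scalerA => tux.
    have -> : val t * u * s = s * (val t * u) by rewrite mulrC.
    by rewrite -scalerA tux scaler0.
  by apply/IE; rewrite scalerA; apply/IE.
have closedI : submod_closed (fun r : R^o => r \in I x).
  split=> [|a u v ux vx]; first exact: (rpred0 (I x)).
  suff: a *: u + v \in I x by [].
  by rewrite rpredD ?rpredZ.
have properI : ~~ ((1 : R^o) \in I x) by apply/negP => /IE; rewrite scale1r.
pose q := Spec closedI properI primeI.
have qE r : (r \in (q : {pred R})) = ((r : R^o) \in I x) by [].
have [s sE] := noethR (I x).
have [||d dP] := @common_den R p R^o (fun r u => r \in I x -> val u *: ((r : R) *: x) = 0) s.
- by move=> r u v /= uP /uP e; rewrite -scalerA e scaler0.
- move=> r; have [/IE/(@loc_in_eq0 R p)[u ux]|nr] := pselect (r \in I x); first by exists u.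
  by exists (done1 p).
exists q; split; last first.
  move=> r; rewrite qE => /IE/(@loc_in_eq0 R p)[u]; rewrite scalerA => urx.
  apply: contrapT => /negP rp; apply: xP; apply/(@loc_in_eq0 R p).
  by exists (dmul u (exist _ r rp)).
exists (val d *: x) => r; rewrite qE; split=> [|rd]; last first.
  by apply/IE/(@loc_in_eq0 R p); exists d; rewrite scalerA mulrC -scalerA.
have [h hE] : exists h : {linear R^o -> X}, forall r, h r = (r : R) *: (val d *: x).
  have /linear_pack[h hE] : linear (fun r : R^o => (r : R) *: (val d *: x)).
    by move=> a u v; rewrite scalerDl -scalerA.
  by exists h.
rewrite -hE sE => rs; apply/kermE; apply: span_sub rs => y ys; apply/kermE.
rewrite hE scalerA mulrC -scalerA; apply: dP => //.
by rewrite sE; exact: mem_span.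
Qed.

Lemma Ass_Supp (X : lmodType R) (p : spec R) : Ass X p -> Supp X p.
Proof.
move=> [x xp]; apply/SuppP; exists x => /(@loc_in_eq0 R p)[s /xp].
exact/negP/(valP s).
Qed.

Lemma Ass_subm (X : lmodType R) (N : submodClosed X) : Ass (subm N) `<=` Ass X.
Proof.
move=> p [x xp]; exists (submv x) => r; rewrite xp; split=> [rx|].
  by rewrite -linearZ rx linear0.
by rewrite -linearZ => rx; apply: val_inj.
Qed.

End AssociatedPrimes.

(** * Extended integers and dimensions *)

Section ExtendedIntegers.
Local Open Scope ereal_scope.
Implicit Types A : set (\bar int).

(** With an integer upper bound there is a greatest element, found by counting
    upwards from any integer in the set; without one the supremum is +oo. *)
Lemma ereal_int_supremums A : A !=set0 -> supremums A !=set0.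
Proof.
move=> [x0 Ax0].
have [[m mub]|noub] := pselect (exists m : int, ubound A m%:E); last first.
  exists +oo; split=> [x _|[m||] yub]; rewrite ?leey//.
    by case: noub; exists m.
  case: noub; exists 0%R => x /yub; rewrite leeNy_eq => /eqP->.
  by rewrite leNye.
have [[k Ak]|noint] := pselect (exists k : int, A k%:E); last first.
  exists -oo; split=> [x Ax|y _]; last by rewrite leNye.
  case: x Ax => [k Ak||] //; first by case: noint; exists k.
  by move=> /mub.
have bound (d : nat) : A (k + d%:Z)%:E -> (d <= `|m - k|)%N.
  by move=> /mub; rewrite lee_fin; lia.
pose P d := `[< A (k + d%:Z)%:E >].
have exP : exists d, P d by exists 0%N; apply/asboolP; rewrite addr0.
have ubP d : P d -> (d <= `|m - k|)%N by move=> /asboolP/bound.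
case: (ex_maxnP exP ubP) => d /asboolP Ad dmax.
exists (k + d%:Z)%:E; split=> [x Ax|y]; last exact.
case: x Ax => [l Al||]; [|by move=> /mub|by rewrite leNye].
rewrite lee_fin; have [lk|kl] := leP l k; first by lia.
have e : (k + `|l - k|%N%:Z)%R = l by lia.
have : (`|l - k| <= d)%N by apply: dmax; apply/asboolP; rewrite e.
by lia.
Qed.

Lemma le_supremum A x : A x -> x <= supremum -oo A.
Proof.
by move=> Ax; apply: ge_supremum_Nmem => //; apply: ereal_int_supremums; exists x.
Qed.

Lemma supremum_le A y : (forall x, A x -> x <= y) -> supremum -oo A <= y.
Proof.
move=> Ay; rewrite /supremum; case: ifPn => [_|/set0P/ereal_int_supremums supA].
  by rewrite leNye.
case: xgetP => [z _ [_]|]; first by apply.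
by case: supA => z /[swap] /(_ z).
Qed.

Lemma infimum_min (A : set (\bar int)) x x0 :
  A x -> lbound A x -> infimum x0 A = x.
Proof.
move=> Ax xA; rewrite /infimum ifF; last by apply/negP => /eqP A0; move: Ax; rewrite A0.
have infx : infimums A x by split=> // y; exact.
case: xgetP => [z _ infz|/(_ x)//].
exact: (is_subset1_infimums infz infx).
Qed.

Lemma infimum_nat (B : set nat) : let m := infimum +oo [set i%:Z%:E | i in B] in
  (B = set0 /\ m = +oo) \/
  exists i, [/\ B i, forall j, B j -> (i <= j)%N & m = i%:Z%:E].
Proof.
move=> m; have [[i0 Bi0]|noB] := pselect (exists i, B i); last first.
  left; have B0 : B = set0 by apply/seteqP; split=> // i Bi; case: noB; exists i.
  by split=> //; rewrite /m B0 image_set0 /infimum eqxx.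
right; have exB : exists i, `[< B i >] by exists i0; apply/asboolP.
case: (ex_minnP exB) => i /asboolP Bi imin; exists i; split=> //.
  by move=> j /asboolP; exact: imin.
apply: infimum_min; first by exists i.
move=> _ [j /asboolP Bj <-]; rewrite lee_fin; have := imin j Bj; lia.
Qed.

End ExtendedIntegers.

Section Dimension.

Section ComapSpec.
Variables (A B : comPzRingType) (f : A -> B).
Hypotheses (fD : {morph f : x y / x + y}) (fM : {morph f : x y / x * y}).
Hypotheses (f0 : f 0 = 0) (f1 : f 1 = 1).

Lemma comap_spec (q : spec B) : exists r : spec A,
  forall x, (x \in (r : {pred A})) = (f x \in (q : {pred B})).
Proof.
have cl : submod_closed (fun x : A^o => f x \in (q : {pred B})).
  split=> [|a u v uq vq]; first by rewrite unfold_in f0; exact: (rpred0 q).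
  suff : f (a * u + v) \in (q : {pred B}) by [].
  have uq' : (f u : B^o) \in (q : submodClosed B^o) by [].
  have vq' : (f v : B^o) \in (q : submodClosed B^o) by [].
  have : f a *: (f u : B^o) + f v \in (q : submodClosed B^o) by rewrite rpredD ?rpredZ.
  by rewrite fD fM.
have pr : ~~ (f 1 \in (q : {pred B})) by rewrite f1; exact: spec_proper.
have pm (x y : A) : f (x * y) \in (q : {pred B}) ->
    (f x \in (q : {pred B})) || (f y \in (q : {pred B})).
  by rewrite fM; exact: spec_prime.
by exists (Spec cl pr pm).
Qed.

(** A chain of primes of B pulls back to a chain of the same length in A; strictness
    is kept since f is onto. *)
Lemma krull_dim_onto : (forall y, exists x, f x = y) ->
  (krull_dim B <= krull_dim A)%E.
Proof.
move=> fonto; apply: supremum_le => _ [k [c cP] <-]; apply: le_supremum.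
exists k => //; have /boolp.choice[d dE] n := comap_spec (c n).
exists d => i /cP[cS nS]; split.
  by move=> x; rewrite !dE; exact: cS.
move=> dS; apply: nS => y yc; have [x xy] := fonto y.
by rewrite -xy -dE; apply: dS; rewrite dE xy.
Qed.

End ComapSpec.

Lemma dim_quot_antitone (R : comPzRingType) (p q : spec R) :
  {subset (q : {pred R}) <= (p : {pred R})} -> (dim_quot p <= dim_quot q)%E.
Proof.
move=> qp.
have qp' : {homo @idfun R^o : x / x \in (q : submodClosed R^o) >-> x \in (p : submodClosed R^o)}.
  by move=> x; exact: qp.
pose f : {linear quotm q -> quotm p} := quotm_map qp'.
have fE (x : R^o) : f (quotm_pi q x) = quotm_pi p x by exact: (quotm_mapE qp').
apply: (@krull_dim_onto (qring q) (qring p) f).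
- exact: (linearD f).
- elim/quotmW=> x; elim/quotmW=> y.
  by rewrite [_ * _ in LHS]qring_mulE !fE [RHS]qring_mulE.
- exact: (linear0 f).
- exact: fE.
by elim/quotmW=> y; exists (quotm_pi q y); exact: fE.
Qed.

(** The supremum is attained as far as comparison with an integer is concerned:
    below n means at most n - 1. *)
Lemma dim_Supp_ge (R : comPzRingType) (X : lmodType R) (n : nat) :
  (n%:Z%:E <= dim_Supp X)%E <-> exists p, Supp X p /\ (n%:Z%:E <= dim_quot p)%E.
Proof.
split=> [nX|[p [Xp np]]]; last by apply: (le_trans np); apply: le_supremum; exists p.
apply: contrapT => no; move: nX; apply/negP; rewrite -ltNge.
apply: (@le_lt_trans _ _ (n%:Z - 1)%:E%E); last by rewrite lte_fin; lia.
apply: supremum_le => _ [p Xp <-].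
have : (dim_quot p < n%:Z%:E)%E.
  by rewrite ltNge; apply/negP => np; apply: no; exists p.
by case: (dim_quot p) => [k||] //; rewrite ?leNye// lee_fin lte_fin; lia.
Qed.

End Dimension.

HB.instance Definition _ (R : comPzRingType) := gen_eqMixin (spec R).

Theorem proposition1p2 (R : comPzRingType) (a b : submodClosed R^o)
    (M : lmodType R) (n : nat)
    (noethR : noetherian R)
    (b_sub_a : {subset b <= a})
    (fgM : finitely_generated (topm M))
    (finAss : forall i : nat, findim_lower a b M n = i%:Z%:E ->
       finite_set (dim_ge (Ass (local_cohomology a M i)) n)) :
  findim_lower a b M n = findim_upper a b M n.
Proof.
pose N t i := ideal_power_lc a b M t i.
(* A and B p are the index sets whose least elements are the lower dimension
   and, by localization, the finiteness dimension at p. *)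
pose A : set nat := [set i | forall t, (n%:Z%:E <= dim_Supp (subm (N t i)))%E].
pose B p : set nat := [set i | forall t, (0 < t)%N -> Supp (subm (N t i)) p].
have findimE p : findim (locideal p a) (locideal p b) (locmod p M) =
    infimum +oo%E [set i%:Z%:E | i in B p].
  congr (infimum _ (_ @` _)); apply/seteqP; split=> i Bi t t0.
    by apply/Supp_ideal_power_lc => //; exact: Bi.
  by apply/Supp_ideal_power_lc => //; exact: Bi.
have expiS t : {subset expi b t.+1 <= expi b t}.
  by move=> r; apply: mulm_sub => s x _; exact: rpredZ.
have N_anti s t i : (s <= t)%N -> {subset N t i <= N s i}.
  move=> /subnK<- x; elim: (t - s)%N => //= k IH xN; apply: IH; move: xN.
  by apply: mulm_sub => r y /expiS rb _; exact: mem_mulm.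
have Supp_anti s t i p : (s <= t)%N -> Supp (subm (N t i)) p -> Supp (subm (N s i)) p.
  move=> st /Supp_subm[x xN x0]; apply/Supp_subm; exists x => //.
  exact: N_anti st x xN.
(* Hence every dimension of a localization is at least the lower dimension. *)
have BA p i : (n%:Z%:E <= dim_quot p)%E -> B p i -> A i.
  move=> np Bi t; apply/dim_Supp_ge; exists p; split=> //.
  by apply: (@Supp_anti t t.+1) => //; exact: Bi.
have lower_case := infimum_nat A; rewrite -/(findim_lower a b M n) in lower_case.
have [[A0 ->]|[i [Ai imin lowE]]] := lower_case.
  have Bp0 p : (n%:Z%:E <= dim_quot p)%E -> 
      findim (locideal p a) (locideal p b) (locmod p M) = +oo%E.
    move=> np; rewrite findimE; have [[_ ->//]|[j [Bj _ _]]] := infimum_nat (B p).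
    by have := BA p j np Bj; rewrite A0.
  have [[p np]|nop] := pselect (exists p : spec R, (n%:Z%:E <= dim_quot p)%E).
    apply/esym/infimum_min; first by exists p => //; exact: Bp0.
    by move=> _ [q nq <-]; rewrite Bp0.
  rewrite /findim_upper /infimum ifT//; apply/eqP/seteqP; split=> // y [p np _].
  by case: nop; exists p.
(* The least i in A lies in some B p: otherwise finitely many exponents, one for
   each associated prime, have a common bound t that contradicts i in A. *)
have [p np Bpi] : exists2 p : spec R, (n%:Z%:E <= dim_quot p)%E & B p i.
  apply: contrapT => noB.
  have /finite_seqP[s sE] := finAss i lowE.
  have [t tP] : exists t, forall p, p \in s -> ~ Supp (subm (N t i)) p.
    have : forall p, p \in s -> (n%:Z%:E <= dim_quot p)%E.
      by move=> p ps; have [] : dim_ge (Ass (local_cohomology a M i)) n p by rewrite sE.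
    elim: s {sE} => [|p s IHs] sn; first by exists 0%N.
    have [q qs|t tP] := IHs; first by apply: sn; rewrite inE qs orbT.
    have [u uP] : exists u, ~ Supp (subm (N u i)) p.
      apply: contrapT => nou; apply: noB; exists p; first by apply: sn; rewrite inE eqxx.
      by move=> u _; apply: contrapT => pu; apply: nou; exists u.
    exists (maxn t u) => q; rewrite inE => /orP[/eqP->|/tP qt].
      by move=> /(Supp_anti _ _ _ _ (leq_maxr t u)).
    by move=> /(Supp_anti _ _ _ _ (leq_maxl t u)).
  (* A prime of large dimension supporting N t i contains an associated prime, which
     has at least that dimension and is one of those treated by t. *)
  have /dim_Supp_ge[p [/(Supp_Ass noethR)[q [qass qp]] np]] := Ai t.
  apply: (tP q); last exact: Ass_Supp.
  have : dim_ge (Ass (local_cohomology a M i)) n q.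
    by split; [exact: (Ass_subm qass)|exact: (le_trans np (dim_quot_antitone qp))].
  by rewrite sE.
rewrite lowE; apply/esym/infimum_min.
  exists p => //; rewrite findimE; apply: infimum_min; first by exists i.
  by move=> _ [j Bj <-]; rewrite lee_fin; have := imin j (BA p j np Bj); lia.
move=> _ [q nq <-]; rewrite findimE.
have [[_ ->]|[j [Bj _ ->]]] := infimum_nat (B q); first by rewrite leey.
by rewrite lee_fin; have := imin j (BA q j nq Bj); lia.
Qed.
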